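(* Let $0\le a_1\le a$ be integers and let $\alpha,\beta,\gamma,\delta,\epsilon,\zeta\in\binom{[a]}{a_1}$ (i.e. $\mathrm{sort}(\alpha)=\mathrm{sort}(\beta)=\mathrm{sort}(\gamma)=\mathrm{sort}(\delta)=\mathrm{sort}(\epsilon)=\mathrm{sort}(\zeta)$). Then $$\mathrm{Hex}(\alpha,\beta,\gamma,\delta,\epsilon,\zeta)=\sum_{\xi,\tau,\lambda,\mu,\rho,\sigma}c_{\beta,\xi}^{\mu}\cdot c_{\lambda^\vee,\xi^\vee}^{\gamma^\vee}\cdot c_{\rho,\lambda}^{\delta^\vee}\cdot c_{\epsilon,\tau}^{\rho}\cdot c_{\sigma^\vee,\tau^\vee}^{\zeta^\vee}\cdot c_{\mu,\sigma}^{\alpha^\vee},$$ where the sum is over all $\xi,\tau,\lambda,\mu,\rho,\sigma\in\binom{[a]}{a_1}$.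
   Context: Strings: $\binom{[n]}{k}$ denotes the set of binary strings (words in $0,1$) of length $n$ with exactly $k$ ones; $\lambda^\vee$ is the reversal of $\lambda$; $\mathrm{sort}(\lambda)=0^{n-k}1^k$ for $\lambda\in\binom{[n]}{k}$. Littlewood-Richardson numbers: for $\lambda,\mu,\nu\in\binom{[n]}{k}$, $c_{\lambda,\mu}^\nu$ is defined by $[X_\lambda][X_\mu]=\sum_{\nu\in\binom{[n]}{k}}c_{\lambda,\mu}^\nu[X_\nu]$ in $H^*(\mathrm{Gr}(k;\mathbb{C}^n))$, where $X_\lambda=\{V:\dim(V\cap\langle e_1,\dots,e_i\rangle)\ge\lambda_1+\dots+\lambda_i\ \forall i\}$ is a Schubert variety. Equivalently it is the usual Littlewood-Richardson coefficient of the partitions attached to the strings, the partition of $\lambda$ having as its $j$-th part the number of $0$s to the right of the $j$-th $1$ in $\lambda$. Puzzles: work in the triangular lattice in the plane, whose unit edges make angles $0^\circ,60^\circ,120^\circ$ with the $x$-axis. Edge labels are the three symbols $0$, $1$, $10$ (where $10$ is a single symbol). A unit triangle (upward- or downward-pointing) with labeled edges is an allowed piece if its three labels read clockwise are $(0,0,0)$, $(1,1,1)$, or a cyclic rotation of $(1,0,10)$. Given a convex lattice polygon (sides along lattice directions) each of whose sides is labeled by a binary string, one symbol per unit edge, read clockwise around the polygon, a puzzle with this boundary is an assignment of labels to all unit lattice edges in the polygon which agrees with the prescribed labels on the boundary and for which every unit triangle in the polygon is an allowed piece. $\mathrm{Hex}(\alpha,\beta,\gamma,\delta,\epsilon,\zeta)$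 is the number of puzzles on the regular hexagon of side length $a$ whose sides, in clockwise order SW, NW, North, NE, SE, South, are labeled respectively $\alpha,\beta,\gamma,\delta,\epsilon,\zeta$, each read clockwise. *)

(* Defs.v *)
From HB Require Import structures.
From mathcomp Require Import all_boot all_order all_algebra.
From mathcomp Require Import mpoly.
From Stdlib Require Import ClassicalEpsilon.

Set Implicit Arguments.
Unset Strict Implicit.
Unset Printing Implicit Defensive.

Import GRing.Theory.
Local Open Scope ring_scope.

(* ---------------------------- Binary strings ------------------------------ *)

Definition bstr (n k : nat) := {s : n.-tuple bool | count id s == k}.

HB.instance Definition _ n k := Finite.on (bstr n k).

Definition bit n k (s : bstr n k) (i : nat) : bool := nth false (val s) i.

Fact brev_subproof n k (s : bstr n k) : count id (rev_tuple (val s)) == k.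
Proof. by rewrite count_rev; case: s. Qed.

Definition brev n k (s : bstr n k) : bstr n k :=
  exist _ (rev_tuple (val s)) (brev_subproof s).

(* ---------------- Schur polynomials and their products -------------------- *)

(* A partition with at most k parts is a weakly decreasing sequence of length
   exactly k, padded with zeros. *)
Definition partition_of (k N : nat) (la : seq nat) : bool :=
  [&& size la == k, sorted geq la & sumn la == N].

(* Boxes (row, column) of the Young diagram of la, both indexed from 0, in the
   English convention (rows from top to bottom). *)
Definition cell (la : seq nat) := {i : 'I_(size la) & 'I_(nth 0%N la i)}.

HB.instance Definition _ la := Finite.on (cell la).

Definition cell_row la (c : cell la) : nat := tag c.
Definition cell_col la (c : cell la) : nat := tagged c.

Definition semistandard k la (T : {ffun cell la -> 'I_k}) : bool :=
  [forall c : cell la, forall d : cell la,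
     ((cell_row c == cell_row d) && (cell_col c < cell_col d) ==> (T c <= T d))
  && ((cell_col c == cell_col d) && (cell_row c < cell_row d) ==> (T c < T d))]%N.

Definition schur (k : nat) (la : seq nat) : {mpoly int[k]} :=
  \sum_(T : {ffun cell la -> 'I_k} | semistandard T)
     \prod_(c : cell la) 'X_(T c).

(* c is the family of coefficients of s_la * s_mu in the basis of the Schur
   polynomials s_nu(x_1, .., x_k), nu having at most k parts; the support
   condition extends c by 0 to all other index sequences. *)
Definition schur_expansion (k : nat) (la mu : seq nat) (c : seq nat -> int) :=
  let N := (sumn la + sumn mu)%N in
  (forall nu, ~~ partition_of k N nu -> c nu = 0) /\
  schur k la * schur k mu =
    \sum_(nu : k.-tuple 'I_N.+1 | partition_of k N (map val nu))
       c (map val nu) *: schur k (map val nu).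

(* The Littlewood-Richardson coefficient of nu in s_la * s_mu. For partitions
   with at most k parts the expansion exists and is unique because the Schur
   polynomials in k variables form a Z-basis of the symmetric polynomials. *)
Definition lr_coef (k : nat) (la mu nu : seq nat) : int :=
  epsilon (inhabits (fun _ : seq nat => 0 : int)) (schur_expansion k la mu) nu.

(* The j-th part is the number of 0s to the right of the j-th 1. *)
Definition bstr_part n k (s : bstr n k) : seq nat :=
  [seq count negb (drop i.+1 (val s)) | i <- iota 0 n & bit s i].

(* The structure constant of the Schubert classes [X_la], [X_mu], [X_nu] in
   H^*(Gr(k; C^n)): [X_la] is the image of the Schur polynomial of bstr_part la,
   with k variables and partitions in a k x (n - k) box. *)
Definition lr n k (la mu nu : bstr n k) : int :=
  lr_coef k (bstr_part la) (bstr_part mu) (bstr_part nu).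

(* --------------------------------- Puzzles -------------------------------- *)

Inductive label := L0 | L1 | L10.

Definition label_code l : 'I_3 :=
  match l with
  | L0 => @Ordinal 3 0 isT | L1 => @Ordinal 3 1 isT | L10 => @Ordinal 3 2 isT
  end.
Definition label_decode (i : 'I_3) : label :=
  match val i with 0%N => L0 | 1%N => L1 | _ => L10 end.
Fact label_codeK : cancel label_code label_decode.
Proof. by case. Qed.

HB.instance Definition _ := Equality.copy label (can_type label_codeK).
HB.instance Definition _ := Choice.copy label (can_type label_codeK).
HB.instance Definition _ := Countable.copy label (can_type label_codeK).
HB.instance Definition _ := Finite.copy label (can_type label_codeK).

Definition label_of_bit (b : bool) : label := if b then L1 else L0.

(* The labels of a triangular piece, in clockwise order. *)
Definition allowed_piece (l1 l2 l3 : label) : bool :=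
  (l1, l2, l3) \in [:: (L0, L0, L0); (L1, L1, L1);
                       (L1, L0, L10); (L0, L10, L1); (L10, L1, L0)].

(* The pair (x, y) stands for the lattice point x * u + y * v, where u and v
   are the unit vectors at angles 0 and 60 degrees. Edges are (d, x, y), with
     D0   joining (x, y)   and (x+1, y),
     D60  joining (x, y)   and (x, y+1),
     D120 joining (x+1, y) and (x, y+1). *)
Inductive dir := D0 | D60 | D120.

Definition dir_code d : 'I_3 :=
  match d with
  | D0 => @Ordinal 3 0 isT | D60 => @Ordinal 3 1 isT | D120 => @Ordinal 3 2 isT
  end.
Definition dir_decode (i : 'I_3) : dir :=
  match val i with 0%N => D0 | 1%N => D60 | _ => D120 end.
Fact dir_codeK : cancel dir_code dir_decode.
Proof. by case. Qed.

HB.instance Definition _ := Equality.copy dir (can_type dir_codeK).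
HB.instance Definition _ := Choice.copy dir (can_type dir_codeK).
HB.instance Definition _ := Countable.copy dir (can_type dir_codeK).
HB.instance Definition _ := Finite.copy dir (can_type dir_codeK).

Definition edge : Type := (dir * nat * nat)%type.

(* The regular hexagon of side a, with vertices, clockwise from the lower left:
   (a, 0), (0, a), (0, 2a), (a, 2a), (2a, a), (2a, 0). *)
Definition in_hex (a : nat) (x y : nat) : bool :=
  [&& x <= 2 * a, y <= 2 * a & a <= x + y <= 3 * a]%N.

Definition edge_in_hex (a : nat) (e : edge) : bool :=
  let: (d, x, y) := e in
  match d with
  | D0   => in_hex a x y && in_hex a x.+1 y
  | D60  => in_hex a x y && in_hex a x y.+1
  | D120 => in_hex a x.+1 y && in_hex a x y.+1
  end.

Definition hex_edges (a : nat) : seq edge :=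
  [seq e <- [seq (dx, y) | dx <- [seq (d, x) | d <- [:: D0; D60; D120],
                                               x <- iota 0 (2 * a).+1],
                           y <- iota 0 (2 * a).+1]
   | edge_in_hex a e].

Definition hex_labeling (a : nat) := {ffun seq_sub (hex_edges a) -> label}.

(* The default value L0 is only returned for edges outside the hexagon. *)
Definition label_at a (f : hex_labeling a) (e : edge) : label :=
  odflt L0 (omap f (insub e)).

Definition up_triangles_ok a (f : hex_labeling a) : bool :=
  [forall x : 'I_(2 * a), forall y : 'I_(2 * a),
     [&& in_hex a x y, in_hex a x.+1 y & in_hex a x y.+1] ==>
     allowed_piece (label_at f (D60, val x, val y))
                   (label_at f (D120, val x, val y))
                   (label_at f (D0, val x, val y))].

Definition down_triangles_ok a (f : hex_labeling a) : bool :=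
  [forall x : 'I_(2 * a), forall y : 'I_(2 * a),
     [&& in_hex a x.+1 y, in_hex a x y.+1 & in_hex a x.+1 y.+1] ==>
     allowed_piece (label_at f (D0, val x, y.+1))
                   (label_at f (D60, x.+1, val y))
                   (label_at f (D120, val x, val y))].

(* side i is the i-th edge (from 0) of a side of the hexagon. *)
Definition side_labeled a k (f : hex_labeling a) (side : nat -> edge)
    (s : bstr a k) : bool :=
  [forall i : 'I_a, label_at f (side i) == label_of_bit (bit s i)].

(* All sides are traversed clockwise. *)
Definition side_SW (a i : nat) : edge := (D120, a - i.+1, i)%N.
Definition side_NW (a i : nat) : edge := (D60, 0, a + i)%N.
Definition side_N  (a i : nat) : edge := (D0, i, 2 * a)%N.
Definition side_NE (a i : nat) : edge := (D120, a + i, 2 * a - i.+1)%N.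
Definition side_SE (a i : nat) : edge := (D60, 2 * a, a - i.+1)%N.
Definition side_S  (a i : nat) : edge := (D0, 2 * a - i.+1, 0)%N.

Definition hex_puzzle a k (al be ga de ep ze : bstr a k)
    (f : hex_labeling a) : bool :=
  [&& up_triangles_ok f, down_triangles_ok f,
      side_labeled f (side_SW a) al, side_labeled f (side_NW a) be,
      side_labeled f (side_N a) ga, side_labeled f (side_NE a) de,
      side_labeled f (side_SE a) ep & side_labeled f (side_S a) ze].

Definition Hex a k (al be ga de ep ze : bstr a k) : nat :=
  #|[set f : hex_labeling a | hex_puzzle al be ga de ep ze f]|.

(* Main.v *)
(* A labeling of the hexagon consists of six triangular puzzles glued along the
   radii. Conservation of the three colors of labels forces the radii to carry
   binary strings with a1 ones, so it remains to see that puzzles on a triangle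
   with sides la, mu, nu are counted by the Littlewood-Richardson coefficient.
   Moving a line with Yang-Baxter weights through the triangle shows that the
   operator la |-> sum_nu N(la, mu, nu) nu commutes with the addition of
   vertical strips, that is, with the multiplication by elementary symmetric
   polynomials. If s is la without its last column, of length r, then la is the
   leading term of e_r s. Hence s_la s_mu = sum_nu N(la, mu, nu) s_nu follows by
   induction from the empty partition, for which the puzzle is forced. *)

Require Import Defs.
From mathcomp Require Import all_boot all_order all_algebra.
From mathcomp Require Import mpoly zify ring lra.
From Stdlib Require Import ClassicalEpsilon FunctionalExtensionality.

Set Implicit Arguments.
Unset Strict Implicit.
Unset Printing Implicit Defensive.

Import GRing.Theory.
Local Open Scope ring_scope.

(** Two truncations shape the proof. Strings with m zeros confine partitions to width m, so adding
    vertical strips is multiplication by e_r only for large m; since a common leading 0 on all three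
    sides forces a whole strip of the puzzle, the counts do not depend on m, which may then exceed
    the degree of the product. The line can also create labels 10 on the South side; test functions
    that vanish on such words discard them, and conservation of colors shows that the puzzles in
    question never need them. The induction needs an order in which the other terms of e_r s come
    before la: a linear statistic on partitions, largest when the strip lies in the top rows,
    provides it. As Schur polynomials are defined by tableaux and the coefficients by choice, two
    classical facts are proved as well. The Pieri rule is obtained on Gelfand-Tsetlin patterns, one
    variable at a time. Uniqueness of the expansion follows from the substitution of X^(B^i) for
    x_i, under which distinct Schur polynomials have distinct lowest terms. *)

Lemma big_label (V : nmodType) (F : label -> V) :
  \sum_l F l = F L0 + F L1 + F L10.
Proof.
rewrite (bigD1 L0) //= (bigD1 L1) //= (bigD1 L10) //= big1 ?addr0 ?addrA //.
by case.
Qed.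

(** Decided by pattern matching, so that it computes in a case analysis of the labels. *)
Definition piece (a b c : label) : bool :=
  match a, b, c with
  | L0, L0, L0 | L1, L1, L1 | L1, L0, L10 | L0, L10, L1 | L10, L1, L0 => true
  | _, _, _ => false
  end.

Lemma pieceE a b c : allowed_piece a b c = piece a b c.
Proof. by case: a; case: b; case: c. Qed.

Lemma piece_rot a b c : piece a b c = piece b c a.
Proof. by case: a; case: b; case: c. Qed.

(** * The Pieri line and its Yang-Baxter relations *)

(* Polynomials as coefficient sequences, so that identities between them are
   decided by computation. *)
Definition cadd := fix cadd (p q : seq nat) : seq nat :=
  match p, q with
  | [::], _ => q
  | _, [::] => p
  | a :: p', b :: q' => (a + b)%N :: cadd p' q'
  end.

Definition cmul := fix cmul (p q : seq nat) : seq nat :=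
  if p is a :: p' then cadd (map (muln a) q) (0%N :: cmul p' q) else [::].

Definition csum (F : label -> seq nat) := cadd (cadd (F L0) (F L1)) (F L10).

Definition ceq := fix ceq (p q : seq nat) : bool :=
  match p, q with
  | [::], _ => all (pred1 0%N) q
  | _, [::] => all (pred1 0%N) p
  | a :: p', b :: q' => (a == b) && ceq p' q'
  end.

Definition call (P : label -> bool) := [&& P L0, P L1 & P L10].

Lemma callP P : call P -> forall l, P l.
Proof. by case/and3P=> ? ? ? []. Qed.

(* Weights of the crossing of a Pieri line with an edge of direction D60 or D0.
   The line goes down, from state s to state t; l and m are the labels of the
   edge on the left and on the right of the line. State L0 is the empty line.
   Each label and each state stands for one of three colors: for D0-edges and
   states, L0, L10, L1 are colors 3, 1, 2; for D60-edges, colors 1, 2, 3; for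
   D120-edges, colors 2, 3, 1. Then a triangle carries every color once, and
   the nonzero weights satisfy an ice rule: the line crosses D60-edges as the
   dual of the vector representation of sl_3. The weights were found by solving
   the local relations below. *)
Definition c60 (s l t m : label) : seq nat :=
  match s, l, t, m with
  | L10, L1, L10, L1 | L1, L1, L1, L1
  | L10, L0, L0, L1 | L1, L10, L0, L1 => [:: 0; 1]
  | L1, L0, L1, L0 | L0, L0, L0, L0 | L0, L10, L0, L10
  | L0, L1, L10, L0 | L0, L1, L1, L10 | L0, L1, L0, L1 => [:: 1]
  | _, _, _, _ => [::]
  end%N.

Definition c0 (s l t m : label) : seq nat :=
  match s, l, t, m with
  | L10, L10, L10, L10 | L1, L1, L1, L1
  | L10, L1, L1, L10 | L10, L0, L0, L10
  | L1, L10, L10, L1 | L1, L0, L0, L1 => [:: 0; 1]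
  | L0, L0, L0, L0 | L10, L1, L10, L1 | L0, L10, L0, L10 | L0, L1, L0, L1
  | L0, L10, L10, L0 | L0, L1, L1, L0 => [:: 1]
  | _, _, _, _ => [::]
  end%N.

Definition cpiece (a b c : label) : seq nat := nseq (piece a b c) 1%N.

Section Weights.
Variables (R : comNzRingType) (x : R).

Definition ceval := foldr (fun (a : nat) r => a%:R + x * r) 0.

Lemma ceval_add p q : ceval (cadd p q) = ceval p + ceval q.
Proof.
elim: p q => [|a p IH] [|b q] //=; rewrite ?add0r ?addr0 //.
by rewrite IH natrD; ring.
Qed.

Lemma ceval_mul p q : ceval (cmul p q) = ceval p * ceval q.
Proof.
elim: p => [|a p IH] /=; first by rewrite mul0r.
rewrite ceval_add /= IH.
have -> : ceval (map (muln a) q) = a%:R * ceval q.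
  by elim: q {IH} => [|b q IH] /=; rewrite ?mulr0 // IH natrM; ring.
by ring.
Qed.

Lemma ceval_sum F : ceval (csum F) = \sum_l ceval (F l).
Proof. by rewrite !ceval_add big_label. Qed.

Lemma ceval_piece a b c : ceval (cpiece a b c) = (piece a b c)%:R.
Proof. by rewrite /cpiece; case: piece; rewrite /= ?mulr0 ?addr0. Qed.

Lemma ceval_eq p q : ceq p q -> ceval p = ceval q.
Proof.
have ceval0 r : all (pred1 0%N) r -> ceval r = 0.
  by elim: r => //= a r IH /andP[/eqP-> /IH->]; rewrite mulr0 addr0.
elim: p q => [|a p IH] [|b q] //.
- by move/ceval0->.
- by move/ceval0->.
by move=> /= /andP[/eqP-> /IH->].
Qed.

Definition w60 s l t m := ceval (c60 s l t m).
Definition w0 s l t m := ceval (c0 s l t m).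

(* On the North-East side, which carries no label 10, the empty line goes
   through unchanged: the weights for D120-edges do not matter. *)
Lemma yb_corner l b c t : b != L10 ->
  \sum_m w60 L0 l t m * (piece m b c)%:R =
  \sum_c' (piece l b c')%:R * w0 L0 c' t c.
Proof.
move=> b01; under eq_bigr do rewrite -ceval_piece -ceval_mul.
under [RHS]eq_bigr do rewrite -ceval_piece -ceval_mul.
rewrite -!ceval_sum; apply: ceval_eq.
by case: b b01 => //= _; case: l; case: c; case: t; vm_compute.
Qed.

(** The two ways for the line to pass a rhombus of the strip with outer labels l (left), c (bottom),
    m (right) and y (top): along the top and left sides here, along the right and bottom sides in
    [cell_rhs]. The line enters in state s and leaves in state t. *)
Definition cell_lhs l c t m y s := csum (fun m' => csum (fun s' => csum (fun z =>
  csum (fun y' => cmul (cmul (c60 s' l t m') (cmul (cpiece m' z c)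
    (cpiece y' m z))) (c0 s y s' y'))))).

Definition cell_rhs l c t m y s := csum (fun c' => csum (fun t' => csum (fun z =>
  csum (fun l' => cmul (c0 t' c' t c) (cmul (cmul (cpiece l z c')
    (cpiece y l' z)) (c60 s l' t' m)))))).

(** The 3^6 outer configurations are checked by computation, [call] being a quantifier over labels
    that computes. *)
Lemma cell_eq l c t m y s : ceq (cell_lhs l c t m y s) (cell_rhs l c t m y s).
Proof.
suff: call (fun l => call (fun c => call (fun t => call (fun m => call (fun y =>
  call (fun s => ceq (cell_lhs l c t m y s) (cell_rhs l c t m y s))))))).
  by move=> H; apply: (callP (callP (callP (callP (callP (callP H l) c) t) m) y)).
by vm_compute.
Qed.

Lemma yb_cell l c t m y s :
  \sum_m' \sum_s' \sum_z \sum_y'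
    w60 s' l t m' * ((piece m' z c)%:R * (piece y' m z)%:R) * w0 s y s' y' =
  \sum_c' \sum_t' \sum_z \sum_l'
    w0 t' c' t c * ((piece l z c')%:R * (piece y l' z)%:R * w60 s l' t' m).
Proof.
transitivity (ceval (cell_lhs l c t m y s)); last first.
  rewrite (ceval_eq (cell_eq l c t m y s)).
  do 4![rewrite ceval_sum; apply: eq_bigr => ? _].
  by rewrite !ceval_mul !ceval_piece.
do 4![rewrite ceval_sum; apply: eq_bigr => ? _].
by rewrite !ceval_mul !ceval_piece.
Qed.
End Weights.

(** * Triangular puzzles *)

Definition gather (T : Type) (f : label -> seq T) := f L0 ++ f L1 ++ f L10.
Arguments gather : simpl never.

Lemma big_gather (V : nmodType) (T : Type) (f : label -> seq T) (F : T -> V) :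
  \sum_(i <- gather f) F i = \sum_l \sum_(i <- f l) F i.
Proof. by rewrite !big_cat big_label /= addrA. Qed.

Lemma gatherP (T : eqType) (f : label -> seq T) t :
  reflect (exists l, t \in f l) (t \in gather f).
Proof.
rewrite !mem_cat; apply: (iffP or3P) => [[] ?|[[] ?]]; try by [exists L0 | exists L1 | exists L10].
- by constructor 1.
- by constructor 2.
- by constructor 3.
Qed.

(* The strip of triangles between a line of D60-edges, labeled la upwards, and
   the next parallel line on its right: c and b are the labels of the D0-edge
   at the bottom and of the D120-edge at the top. The list contains the labels
   of the next line for all puzzles on the strip. *)
Fixpoint strip (la : seq label) (c b : label) : seq (seq label) :=
  if la is l :: la' then
    if nilp la' then nseq (piece l b c) [::] else
    gather (fun z => gather (fun y => gather (fun m =>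
      if piece l z c && piece y m z then [seq m :: r | r <- strip la' y b]
      else [::])))
  else [::].

(* The South sides, read from left to right, of all puzzles on the up-pointing
   triangle with North-West side la and North-East side mu. *)
Fixpoint tri (la mu : seq label) : seq (seq label) :=
  if mu is b :: mu' then
    gather (fun c => flatten [seq [seq c :: nu | nu <- tri r mu'] | r <- strip la c b])
  else [:: [::]].

Lemma sum_strip1 (V : nmodType) l c b (G : seq label -> V) :
  \sum_(r <- strip [:: l] c b) G r = G [::] *+ piece l b c.
Proof. by rewrite /=; case: piece; rewrite /= ?big_cons ?big_nil ?addr0. Qed.

Lemma sum_strip (V : nmodType) l la c b (G : seq label -> V) : ~~ nilp la ->
  \sum_(r <- strip (l :: la) c b) G r =
  \sum_z \sum_y \sum_m (\sum_(r <- strip la y b) G (m :: r))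
    *+ (piece l z c && piece y m z).
Proof.
move=> /negPf /= ->; rewrite big_gather; apply: eq_bigr => z _.
rewrite big_gather; apply: eq_bigr => y _; rewrite big_gather.
by apply: eq_bigr => m _; case: ifP; rewrite ?big_nil // big_map.
Qed.

Lemma sum_tri (V : nmodType) la b mu (K : seq label -> V) :
  \sum_(nu <- tri la (b :: mu)) K nu =
  \sum_c \sum_(r <- strip la c b) \sum_(nu <- tri r mu) K (c :: nu).
Proof.
rewrite /= big_gather; apply: eq_bigr => c _.
rewrite big_flatten /= big_map; apply: eq_bigr => r _.
by rewrite big_map.
Qed.

Lemma size_strip la c b r : r \in strip la c b -> size r = (size la).-1.
Proof.
elim: la c r => //= l la IH c r; case: nilP => [->|/eqP la0].
  by case: piece; rewrite //= inE => /eqP->.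
case/gatherP=> z /gatherP[y /gatherP[m]].
case: ifP => // _ /mapP[r' /IH r'E ->] /=.
by rewrite r'E; case: la la0 {IH r'E}.
Qed.

Lemma sum_label0 (V : nmodType) (F : label -> V) :
  (forall l, l != L0 -> F l = 0) -> \sum_l F l = F L0.
Proof. by move=> F0; rewrite big_label !(F0 L1, F0 L10) // !addr0. Qed.

Lemma exchange_big4 (V : nmodType) (I J : finType) (F : I -> I -> I -> I -> J -> V) :
  \sum_a \sum_b \sum_c \sum_d \sum_j F a b c d j =
  \sum_j \sum_a \sum_b \sum_c \sum_d F a b c d j.
Proof.
by do 4![rewrite [RHS]exchange_big; apply: eq_bigr => ? _].
Qed.

Lemma sum_triple (V : nmodType) (I : finType) (F : I -> I -> I -> V) :
  \sum_(p : I * I * I) F p.1.1 p.1.2 p.2 = \sum_a \sum_b \sum_c F a b c.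
Proof. by rewrite !pair_bigA. Qed.

Section Line.
Variables (R : comNzRingType) (x : R).

(* The line through the edges labeled la, listed upwards, with state t at the
   bottom and the empty state at the top. *)
Fixpoint line (w : label -> label -> label -> label -> R) (t : label)
    (la : seq label) : seq (R * seq label) :=
  if la is l :: la' then
    gather (fun m => gather (fun s =>
      [seq (w s l t m * p.1, m :: p.2) | p <- line w s la']))
  else nseq (t == L0) (1, [::]).

Definition lin w t la (G : seq label -> R) : R :=
  \sum_(p <- line w t la) p.1 * G p.2.

Lemma lin_nil w t G : lin w t [::] G = G [::] *+ (t == L0).
Proof. by rewrite /lin /=; case: eqP; rewrite ?big_seq1 ?big_nil //= mul1r. Qed.

Lemma lin_cons w t l la G :
  lin w t (l :: la) G =
  \sum_m \sum_s w s l t m * lin w s la (fun r => G (m :: r)).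
Proof.
rewrite /lin /= big_gather; apply: eq_bigr => m _.
rewrite big_gather; apply: eq_bigr => s _.
by rewrite big_map mulr_sumr; apply: eq_bigr => p _; rewrite mulrA.
Qed.

Lemma size_line w t la p : p \in line w t la -> size p.2 = size la.
Proof.
elim: la t p => [|l la IH] t p /=; first by rewrite mem_nseq => /andP[_ /eqP->].
by case/gatherP=> m /gatherP[s /mapP[q /IH <- ->]].
Qed.

Lemma eq_lin w t la G G' : (forall r, size r = size la -> G r = G' r) ->
  lin w t la G = lin w t la G'.
Proof. by move=> GG'; apply: eq_big_seq => p /size_line /GG'->. Qed.

Lemma lin_sum w t la (I : Type) (s : seq I) F :
  lin w t la (fun r => \sum_(i <- s) F i r) = \sum_(i <- s) lin w t la (F i).
Proof.
by rewrite exchange_big /=; apply: eq_bigr => p _; rewrite mulr_sumr.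
Qed.

Lemma lin_mul w t la a F : lin w t la (fun r => a * F r) = a * lin w t la F.
Proof. by rewrite mulr_sumr; apply: eq_bigr => p _; rewrite mulrCA. Qed.

Lemma lin_muln w t la k F : lin w t la (fun r => F r *+ k) = lin w t la F *+ k.
Proof. by rewrite -sumrMnl; apply: eq_bigr => p _; rewrite mulrnAr. Qed.

(** A train argument: the line is pushed through the single triangle at the top by [yb_corner] and
    then down through the rhombi by [yb_cell]. It ends up crossing the bottom edge, with c' on its
    left and c on its right. *)
Lemma lin_strip la t c b G : b != L10 -> ~~ nilp la ->
  lin (w60 x) t la (fun r => \sum_(r' <- strip r c b) G r') =
  \sum_c' \sum_t' w0 x t' c' t c *
    \sum_(r <- strip la c' b) lin (w60 x) t' r G.
Proof.
move=> b01; elim: la t c G => // l la IH t c G _.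
case: (boolP (nilp la)) => [/nilP->|la0].
  transitivity (\sum_m w60 x L0 l t m * (piece m b c)%:R * G [::]).
    rewrite lin_cons; apply: eq_bigr => m _.
    rewrite sum_label0 => [|s s0].
      by rewrite lin_nil eqxx mulr1n sum_strip1 -mulrA mulr_natl.
    by rewrite lin_nil (negPf s0) mulr0.
  rewrite -mulr_suml (yb_corner x l c t b01) mulr_suml; apply: eq_bigr => c' _.
  rewrite sum_label0 => [|s s0].
    by rewrite sum_strip1 lin_nil eqxx mulr1n -mulrA mulr_natl mulrnAr.
  by rewrite sum_strip1 lin_nil (negPf s0) mul0rn mulr0.
(* The strip above the lowest rhombus, with the line already on its right. The induction hypothesis
   produces these terms; [yb_cell] treats the rhombus that remains. *)
pose Q y' s' m := \sum_(r <- strip la y' b) lin (w60 x) s' r (fun r => G (m :: r)).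
transitivity (\sum_(p : label * label * label) \sum_m' \sum_s \sum_z \sum_y
    w60 x s l t m' * ((piece m' z c)%:R * (piece y p.1.2 z)%:R) * w0 x p.2 p.1.1 s y
    * Q p.1.1 p.2 p.1.2).
  rewrite lin_cons -exchange_big4; apply: eq_bigr => m' _; apply: eq_bigr => s _.
  rewrite (@eq_lin _ _ _ _ (fun r => \sum_z \sum_y \sum_m
     (\sum_(r' <- strip r y b) G (m :: r')) *+ (piece m' z c && piece y m z))); last first.
    by move=> r rE; rewrite sum_strip // /nilp rE.
  rewrite lin_sum mulr_sumr; apply: eq_bigr => z _.
  rewrite lin_sum mulr_sumr; apply: eq_bigr => y _.
  rewrite (sum_triple (fun y' m s' => w60 x s l t m' * ((piece m' z c)%:R *
    (piece y m z)%:R) * w0 x s' y' s y * Q y' s' m)) exchange_big /=.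
  rewrite lin_sum mulr_sumr.
  apply: eq_bigr => m _; rewrite lin_muln IH // -[_ *+ _]mulr_natl mulrA mulr_sumr.
  apply: eq_bigr => y' _; rewrite mulr_sumr; apply: eq_bigr => s' _.
  by rewrite mulrA -mulnb natrM.
transitivity (\sum_(p : label * label * label) \sum_c' \sum_t' \sum_z \sum_l'
    w0 x t' c' t c * ((piece l z c')%:R * (piece p.1.1 l' z)%:R * w60 x p.2 l' t' p.1.2)
    * Q p.1.1 p.2 p.1.2).
  apply: eq_bigr => p _; have := yb_cell x l c t p.1.2 p.1.1 p.2.
  move/(congr1 (fun v => v * Q p.1.1 p.2 p.1.2)); rewrite !mulr_suml => yb.
  transitivity (\sum_m' (\sum_s \sum_z \sum_y
    w60 x s l t m' * ((piece m' z c)%:R * (piece y p.1.2 z)%:R) * w0 x p.2 p.1.1 s y)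
    * Q p.1.1 p.2 p.1.2).
    by apply: eq_bigr => ? _; do 3![rewrite mulr_suml; apply: eq_bigr => ? _].
  by rewrite yb; apply: eq_bigr => ? _; do 3![rewrite mulr_suml; apply: eq_bigr => ? _].
rewrite -exchange_big4; apply: eq_bigr => c' _; apply: eq_bigr => t' _.
rewrite sum_strip // mulr_sumr; apply: eq_bigr => z _.
rewrite mulr_sumr; under [RHS]eq_bigr do rewrite mulr_sumr.
rewrite [RHS]exchange_big; apply: eq_bigr => l' _.
rewrite (sum_triple (fun y' m s' => w0 x t' c' t c * ((piece l z c')%:R *
  (piece y' l' z)%:R * w60 x s' l' t' m) * Q y' s' m)).
apply: eq_bigr => y' _.
rewrite -[_ *+ nat_of_bool (_ && _)]mulr_natl -mulnb natrM [RHS]mulrA.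
under [in RHS]eq_bigr do rewrite lin_cons.
rewrite [in RHS]exchange_big mulr_sumr; apply: eq_bigr => m _.
rewrite [in RHS]exchange_big mulr_sumr; apply: eq_bigr => s' _.
by rewrite -mulr_sumr !mulrA.
Qed.
(** Every strip leaves one crossing with a D0-edge, and together these crossings form the line
    through the South side. *)
Lemma lin_tri la mu t K : L10 \notin mu -> size la = size mu ->
  lin (w60 x) t la (fun r => \sum_(nu <- tri r mu) K nu) =
  \sum_(nu <- tri la mu) lin (w0 x) t nu K.
Proof.
elim: mu la t K => [|b mu IH] la t K.
  by move=> _ /size0nil->; rewrite lin_nil !big_seq1 lin_nil.
rewrite inE negb_or eq_sym => /andP[b01 mu01] lamu.
under eq_lin do rewrite sum_tri.
rewrite lin_sum sum_tri; under [RHS]eq_bigr do under eq_bigr do under eq_bigr do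
  rewrite lin_cons.
under [RHS]eq_bigr do under eq_bigr do rewrite exchange_big.
under [RHS]eq_bigr do rewrite exchange_big.
rewrite [RHS]exchange_big; apply: eq_bigr => c _.
rewrite lin_strip //; last by rewrite /nilp lamu.
apply: eq_bigr => c' _.
under [RHS]eq_bigr do rewrite exchange_big.
rewrite [RHS]exchange_big; apply: eq_bigr => t' _.
rewrite mulr_sumr; apply: eq_big_seq => r /size_strip rE.
by rewrite IH ?rE ?lamu // mulr_sumr.
Qed.
End Line.

(** * Partitions and binary strings *)

Definition lab := map label_of_bit.

Lemma lab01 s : L10 \notin lab s.
Proof. by apply/mapP=> -[[]]. Qed.

Lemma lab_inj : injective lab.
Proof. by apply: inj_map => -[] []. Qed.

(* The string with m zeros whose j-th one is followed by p_j zeros; p is a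
   weakly decreasing sequence with entries at most m. *)
Fixpoint str (m : nat) (p : seq nat) : seq bool :=
  if p is l :: p' then nseq (m - l) false ++ true :: str l p' else nseq m false.

Fixpoint parts (s : seq bool) : seq nat :=
  if s is b :: s' then nseq b (count negb s') ++ parts s' else [::].

Lemma size_parts s : size (parts s) = count id s.
Proof. by elim: s => //= b s IH; rewrite size_cat size_nseq IH. Qed.

Lemma path_parts s m : (count negb s <= m)%N -> path geq m (parts s).
Proof.
elim: s m => //= -[] s IH m /= sm; first by rewrite sm IH.
by apply: IH; apply: leq_trans sm; rewrite leq_addl.
Qed.

Lemma strS m p : path geq m p -> str m.+1 p = false :: str m p.
Proof. by case: p => //= l p /andP[lm _]; rewrite subSn. Qed.

Lemma str_parts s : str (count negb s) (parts s) = s.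
Proof.
elim: s => //= -[] s IH /=; first by rewrite subnn IH.
by rewrite add1n strS ?IH // path_parts.
Qed.

Lemma size_str m p : path geq m p -> size (str m p) = (m + size p)%N.
Proof.
elim: p m => [|l p IH] m /=; first by rewrite size_nseq addn0.
case/andP=> lm lp; rewrite size_cat size_nseq /= IH //.
by rewrite addnS addnA subnK // addnS.
Qed.

Lemma count_str m p : path geq m p -> count id (str m p) = size p.
Proof.
elim: p m => [|l p IH] m /=; first by rewrite count_nseq.
by case/andP=> lm lp; rewrite count_cat count_nseq /= IH.
Qed.

Lemma parts_str_sorted m p : sorted geq p -> parts (str m p) = p.
Proof.
have parts0 k s : parts (nseq k false ++ s) = parts s by elim: k.
elim: p m => [|l p IH] m /=; first by rewrite -[nseq _ _]cats0 parts0.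
move=> lp; rewrite parts0 /= IH ?(path_sorted lp) //; congr (_ :: _).
have := count_predC id (str l p); rewrite count_str // size_str //.
by rewrite addnC => /addIn.
Qed.

Lemma parts_str m p : path geq m p -> parts (str m p) = p.
Proof. by move/path_sorted/parts_str_sorted. Qed.

Lemma path_geqW m n p : (m <= n)%N -> path geq m p -> path geq n p.
Proof. by case: p => //= a p mn /andP[/leq_trans-> //]. Qed.

Lemma bstr_partE n k (s : bstr n k) : bstr_part s = parts (val s).
Proof.
rewrite /bstr_part /bit -[in iota 0 n](size_tuple (val s)).
elim: (tval _) => //= b r IH.
rewrite (iotaDl 1 0) filter_map.
have -> : [seq i <- iota 0 (size r) | preim (addn 1) [eta nth false (b :: r)] i]
  = [seq i <- iota 0 (size r) | nth false r i] by [].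
by case: b => /=; rewrite -map_comp ?drop0 -IH.
Qed.

(* The sequences q <= m obtained from p by adding a vertical strip. *)
Fixpoint vstrips (m : nat) (p : seq nat) : seq (seq nat) :=
  if p is l :: p' then
    [seq l :: q | q <- vstrips l p'] ++
    (if (l < m)%N then [seq l.+1 :: q | q <- vstrips l.+1 p'] else [::])
  else [:: [::]].

Lemma vstrips_path m p q : path geq m p -> q \in vstrips m p ->
  path geq m q /\ size q = size p.
Proof.
elim: p m q => [|l p IH] m q /=; first by rewrite inE => _ /eqP->.
case/andP=> lm lp; rewrite mem_cat => /orP[/mapP[r rp ->]|].
  by case: (IH _ _ lp rp) => lr /= ->; rewrite lm.
case: ifP => // {}lm /mapP[r rp ->].
have {}lp : path geq l.+1 p by case: p lp {IH rp} => //= a p /andP[/leqW->].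
by case: (IH _ _ lp rp) => lr /= ->; rewrite lm.
Qed.

Lemma vstrips_sumn m p q : path geq m p -> q \in vstrips m p ->
  (sumn p <= sumn q)%N.
Proof.
elim: p m q => [|l p IH] m q /=; first by rewrite inE => _ /eqP->.
case/andP=> lm lp; rewrite mem_cat => /orP[/mapP[r rp ->]|].
  by rewrite leq_add2l (IH _ _ lp).
case: ifP => // {}lm /mapP[r rp ->].
have {}lp : path geq l.+1 p by case: p lp {IH rp} => //= a p /andP[/leqW->].
by rewrite leq_add // (IH _ _ lp).
Qed.

(** The mechanism common to both kinds of weights. Read upwards, the line turns a block 0 1^j into
    1^j 0 with weight x^j, that is, it adds a box to each of j rows; C is its state inside such a
    block. The predicate [good] restricts the test functions, because with the weights [w0] the line
    can also create labels 10. *)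
Section LineStr.
Variables (R : comNzRingType) (x : R) (w : label -> label -> label -> label -> R).
Variables (C : label) (good : (seq label -> R) -> Prop).
Hypothesis C0 : C != L0.
Hypothesis good_cons : forall b G, good G -> good (fun r => G (label_of_bit b :: r)).
Hypothesis lin00 : forall la G, good G -> lin w L0 (L0 :: la) G =
  lin w L0 la (fun r => G (L0 :: r)) + x * lin w C la (fun r => G (L1 :: r)).
Hypothesis lin01 : forall la G, good G -> lin w L0 (L1 :: la) G =
  lin w L0 la (fun r => G (L1 :: r)).
Hypothesis linC0 : forall la G, good G -> lin w C (L0 :: la) G = 0.
Hypothesis linC1 : forall la G, good G -> lin w C (L1 :: la) G =
  lin w L0 la (fun r => G (L0 :: r)) + x * lin w C la (fun r => G (L1 :: r)).

(* The second part describes a line that has just turned a 0 into a 1 and is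
   about to cross the next 1. *)
Lemma lin_str m p G : path geq m p -> good G ->
  lin w L0 (lab (str m p)) G =
    \sum_(q <- vstrips m p) x ^+ (sumn q - sumn p) * G (lab (str m q)) /\
  lin w C (lab (true :: str m p)) G =
    \sum_(q <- vstrips m.+1 p) x ^+ (sumn q - sumn p) * G (lab (str m.+1 q)).
Proof.
have good0 F : good F -> good (fun r => F (L0 :: r)) by move/(good_cons false).
have good1 F : good F -> good (fun r => F (L1 :: r)) by move/(good_cons true).
elim: p m G => [|l p IH] m G mp gG.
  have E k F : good F -> lin w L0 (nseq k L0) F = F (nseq k L0).
    elim: k F => [|k IHk] F gF; first by rewrite lin_nil mulr1n.
    rewrite /= lin00 // IHk; last exact: good0.
    case: k {IHk} => [|k]; last by rewrite /= linC0 ?mulr0 ?addr0 //; exact: good1.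
    by rewrite /= lin_nil (negPf C0) mulr0 addr0.
  rewrite /= !big_seq1 !expr0 !mul1r /lab !map_nseq /= linC1 // !E //; last exact: good0.
  split=> //; case: m {mp} => [|m]; first by rewrite /= lin_nil (negPf C0) mulr0 addr0.
  by rewrite /= linC0 ?mulr0 ?addr0 //; exact: good1.
have sumS k : (sumn (k :: p) = k + sumn p)%N by [].
have IHl F : good F -> lin w L0 (lab (str l p)) (fun r => F (L1 :: r)) =
    \sum_(q <- [seq l :: q | q <- vstrips l p]) x ^+ (sumn q - sumn (l :: p)) *
      F (lab (str l q)).
  move=> gF; have lp : path geq l p by case/andP: mp.
  rewrite (IH l _ lp (good1 _ gF)).1 big_map; apply: eq_bigr => q _.
  by rewrite /= subnDl subnn.
have IHr F : good F -> lin w C (lab (true :: str l p)) (fun r => F (L1 :: r)) * x =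
    \sum_(q <- [seq l.+1 :: q | q <- vstrips l.+1 p]) x ^+ (sumn q - sumn (l :: p)) *
      F (lab (str l.+1 q)).
  move=> gF; have lp : path geq l p by case/andP: mp.
  rewrite (IH l _ lp (good1 _ gF)).2 big_map mulr_suml; apply: eq_big_seq => q.
  have lp' : path geq l.+1 p by case: (p) lp => //= a s /andP[/leqW->].
  move/(vstrips_sumn lp') => pq.
  by rewrite mulrAC -exprSr /= subnn addSn subSn ?leq_add2l // subnDl.
have strF k r F : path geq k (l :: p) -> r \in vstrips k (l :: p) ->
    F (L0 :: lab (str k r)) = F (lab (str k.+1 r)) :> R.
  by move=> kp /(vstrips_path kp)[kq _]; rewrite (strS kq).
have lp : path geq l p by case/andP: mp.
(* Of the zeros in front of the first 1 only the last can start a block: by [linC0], a 0 that is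
   turned into a 1 cannot be followed by a 0. *)
have S k F : (l <= k)%N -> good F -> lin w L0 (lab (str k (l :: p))) F =
    \sum_(q <- vstrips k (l :: p)) x ^+ (sumn q - sumn (l :: p)) * F (lab (str k q)).
  move/subnKC <-; elim: (k - l)%N F => {k} [|[|k] IHk] F gF.
  - rewrite addn0 /= subnn /= lin01 // IHl // ltnn cats0.
    by [].
  - rewrite addn1 strS /= ?subnn ?leqnn //= lin00 // lin01; last exact: good0.
    rewrite ?ltnSn big_cat /= -IHr // [x * _]mulrC; congr (_ + _).
    rewrite (IHl (fun r => F (L0 :: r))); last exact: good0.
    apply: eq_big_seq => q /mapP[r rp ->]; congr (_ * _).
    apply: strF; rewrite /= ?leqnn //.
    by rewrite mem_cat map_f.
  rewrite addnS strS /= ?leq_addr //= lin00 // IHk; last exact: good0.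
  rewrite addnS subSn ?leq_addr //= linC0 ?mulr0 ?addr0; last exact: good1.
  have -> : (l < (l + k).+1)%N by rewrite ltnS leq_addr.
  apply: eq_big_seq => q qp; congr (_ * _).
  rewrite (strF (l + k).+1) //=; first by rewrite leqW ?leq_addr.
  by have -> : (l < (l + k).+1)%N by rewrite ltnS leq_addr.
split; first by apply: S => //; case/andP: mp.
have lm : (l <= m)%N by case/andP: mp.
rewrite /= linC1 // (S m); [|by []|exact: good0].
have -> : \sum_(q <- vstrips m (l :: p)) x ^+ (sumn q - sumn (l :: p)) *
     G (L0 :: lab (str m q)) =
     \sum_(q <- vstrips m (l :: p)) x ^+ (sumn q - sumn (l :: p)) *
     G (lab (str m.+1 q)).
  by apply: eq_big_seq => q qp; rewrite (strF m).
rewrite /= ltnS lm; case: ltnP => lm'.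
  rewrite -(subnKC lm') addSn subSn ?leq_addr //= linC0 ?mulr0 ?addr0 //.
  exact: good1.
have <- : l = m by apply/eqP; rewrite eqn_leq lm.
rewrite cats0 subnn /= mulrC IHr //.
by rewrite big_cat.
Qed.
End LineStr.

(** * Conservation of the three colors *)

(* The labels p, q, r have the same color on D60-, D120-, D0-edges. *)
Definition is_color (p q r : label) :=
  forall a b c, piece a b c -> ((a == p) + (b == q) + (c == r) = 1)%N.

Lemma is_color3 : is_color L1 L10 L0.
Proof. by case=> -[] []. Qed.

Lemma is_color1 : is_color L0 L1 L10.
Proof. by case=> -[] []. Qed.

Lemma is_color2 : is_color L10 L0 L1.
Proof. by case=> -[] []. Qed.

Lemma color_strip p q r la c b s : is_color p q r -> s \in strip la c b ->
  (count_mem p la + (b == q) + (c == r) = (count_mem p s).+1)%N.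
Proof.
move=> pqr; elim: la c s => // l la IH c s /=.
case: nilP => [->|_].
  by rewrite mem_nseq => /andP[]; rewrite lt0b => /pqr e /eqP-> /=; rewrite addn0.
case/gatherP=> z /gatherP[y /gatherP[m]].
case: ifP => // /andP[/pqr lzc]; rewrite piece_rot => /pqr mzy /mapP[t tP ->] /=.
move: lzc mzy (IH _ _ tP); move: (nat_of_bool (l == p)) (nat_of_bool (z == q)) =>
  lp zq; move: (nat_of_bool (m == p)) (nat_of_bool (c == r)) (nat_of_bool (y == r)) =>
  mp cr yr; move: (nat_of_bool (b == q)) (count_mem p la) (count_mem p t); lia.
Qed.

Lemma size_tri la mu nu : nu \in tri la mu -> size nu = size mu.
Proof.
elim: mu la nu => [|b mu IH] la nu /=; first by rewrite inE => /eqP->.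
by case/gatherP=> c /flatten_mapP[r _ /mapP[t /IH <- ->]].
Qed.

(** Every piece carries the color once and every inner edge belongs to one up-pointing and one
    down-pointing piece. So the boundary carries the color as often as there are more pieces of the
    first kind than of the second. *)
Lemma color_tri p q r la mu nu : is_color p q r -> size la = size mu ->
  nu \in tri la mu ->
  (count_mem p la + count_mem q mu + count_mem r nu = size la)%N.
Proof.
move=> pqr; elim: mu la nu => [|b mu IH] la nu.
  by move/size0nil->; rewrite inE => /eqP->.
move=> lamu /gatherP[c /flatten_mapP[s sP /mapP[t tP ->]]] /=.
have := color_strip pqr sP; have ss := size_strip sP.
have := IH s t; rewrite ss lamu /= => /(_ erefl tP).
by lia.
Qed.

Lemma count_lab s :
  [/\ count_mem L0 (lab s) = count negb s, count_mem L1 (lab s) = count id s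
    & count_mem L10 (lab s) = 0%N].
Proof.
by rewrite /lab !count_map; split; [apply: eq_count|apply: eq_count|
  rewrite -(count_pred0 s); apply: eq_count]; case.
Qed.

Lemma labK nu : L10 \notin nu -> lab (map (pred1 L1) nu) = nu.
Proof.
by elim: nu => //= a nu IH; rewrite inE negb_or => /andP[a0 /IH->]; case: a a0.
Qed.

(** The zeros of s and the ones of u have the same color and already exhaust its total, so no label
    10 is left for the South side. *)
Lemma tri_lab s u nu : size s = size u -> count id s = count id u ->
  nu \in tri (lab s) (lab u) ->
  exists v, [/\ nu = lab v, size v = size s & count id v = count id s].
Proof.
move=> su cu nuP; have su' : size (lab s) = size (lab u) by rewrite !size_map.
have := color_tri is_color1 su' nuP; have := color_tri is_color2 su' nuP.
have [-> _ ->] := count_lab s; have [-> -> _] := count_lab u.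
have sC : (count id s + count negb s)%N = size s by exact: count_predC.
have uC : (count id s + count negb u)%N = size s by rewrite cu su; apply: count_predC.
rewrite size_map -cu => e2; rewrite -sC => e1.
have nu0 : L10 \notin nu.
  by rewrite -has_pred1 has_count -leqNgt leqn0 -(eqn_add2l (count id s + count negb s))
    addn0 [X in (X + _)%N]addnC; apply/eqP.
exists (map (pred1 L1) nu); split; first by rewrite labK.
  by rewrite size_map (size_tri nuP) size_map -su.
have [_ <- _] := count_lab (map (pred1 L1) nu); rewrite labK //.
by apply/eqP; rewrite -(eqn_add2r (count negb u)) uC -e2 addnC.
Qed.

(** * Commutation of puzzles with vertical strips *)

Definition unlab (nu : seq label) := parts (map (pred1 L1) nu).

Lemma unlab_lab s : unlab (lab s) = parts s.
Proof.
rewrite /unlab /lab -map_comp; congr parts.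
by rewrite -[RHS]map_id; apply: eq_map => -[].
Qed.

Lemma tri_str m p q nu : path geq m p -> path geq m q -> size p = size q ->
  nu \in tri (lab (str m p)) (lab (str m q)) ->
  [/\ nu = lab (str m (unlab nu)), path geq m (unlab nu) & size (unlab nu) = size p].
Proof.
move=> mp mq pq /tri_lab []; rewrite ?size_str ?count_str ?pq // => v [-> sv cv].
have <- : count negb v = m.
  by have := count_predC id v; rewrite sv cv addnC => /addIn.
by rewrite unlab_lab str_parts path_parts // size_parts cv.
Qed.

Lemma lin60_str (R : comNzRingType) (x : R) m p G : path geq m p ->
  lin (w60 x) L0 (lab (str m p)) G =
  \sum_(q <- vstrips m p) x ^+ (sumn q - sumn p) * G (lab (str m q)).
Proof.
move=> mp; apply: (lin_str (C := L10) (good := fun _ => True) _ _ _ _ _ _ mp I).1 => //.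
all: move=> la F _; rewrite lin_cons !big_label /w60 /=.
all: by rewrite !(mulr0, addr0, add0r, mul0r, mul1r, mulr1) // addrC.
Qed.

Lemma lin0_str (R : comNzRingType) (x : R) m p G :
  (forall t, L10 \in t -> G t = 0) -> path geq m p ->
  lin (w0 x) L0 (lab (str m p)) G =
  \sum_(q <- vstrips m p) x ^+ (sumn q - sumn p) * G (lab (str m q)).
Proof.
move=> G0 mp.
have lin0 s la (F : seq label -> R) : (forall t, L10 \in t -> F t = 0) ->
    lin (w0 x) s la (fun r => F (L10 :: r)) = 0.
  move=> F0; rewrite (@eq_lin _ _ _ _ _ (fun=> 0 * 0)) => [|r _].
    by rewrite lin_mul mul0r.
  by rewrite F0 ?mul0r // inE.
apply: (lin_str (C := L1) (good := fun F => forall t, L10 \in t -> F t = 0)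
  _ _ _ _ _ _ mp G0).1 => //.
- by move=> b F F0 t t0; rewrite F0 // inE t0 orbT.
all: move=> la F F0; rewrite lin_cons !big_label /w0 /=.
all: by rewrite !lin0 // !(mulr0, addr0, add0r, mul0r, mul1r, mulr1) // addrC.
Qed.

(** Comparison of the coefficients of x^r in [lin_tri], where x is the indeterminate of a polynomial
    ring. *)
Lemma tri_vstrips (S : comNzRingType) m p u r (K : seq nat -> S) :
  path geq m p -> path geq m u -> size p = size u ->
  \sum_(p' <- vstrips m p | sumn p' == (sumn p + r)%N)
    \sum_(nu <- tri (lab (str m p')) (lab (str m u))) K (unlab nu) =
  \sum_(nu <- tri (lab (str m p)) (lab (str m u)))
    \sum_(q <- vstrips m (unlab nu) | sumn q == (sumn (unlab nu) + r)%N) K q.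
Proof.
move=> mp mu pu.
(* Vanishing on words with a label 10 is what [lin0_str] requires; on the puzzles of the left side
   such words do not occur, by [tri_str]. *)
pose G nu : {poly S} := if L10 \in nu then 0 else (K (unlab nu))%:P.
have coefE (q : seq nat) (F : seq nat -> S) : path geq m q ->
    (\sum_(q' <- vstrips m q) 'X^(sumn q' - sumn q) * (F q')%:P)`_r =
    \sum_(q' <- vstrips m q | sumn q' == (sumn q + r)%N) F q'.
  move=> mq; rewrite coef_sum [RHS]big_mkcond; apply: eq_big_seq => q' q'P.
  rewrite coefMC coefXn; have := vstrips_sumn mq q'P.
  move=> qq; have -> : (r == sumn q' - sumn q)%N = (sumn q' == sumn q + r)%N.
    by rewrite -{2}(subnKC qq) eqn_add2l eq_sym.
  by case: eqP; rewrite ?mul1r ?mul0r.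
have := @lin_tri _ ('X : {poly S}) (lab (str m p)) (lab (str m u)) L0 G.
rewrite lab01 !size_map !size_str // pu => /(_ isT erefl) e.
transitivity (\sum_(nu <- tri (lab (str m p)) (lab (str m u)))
    lin (w0 'X) L0 nu G)`_r.
  rewrite -e lin60_str //.
  rewrite -coefE //; apply: (congr1 (fun f : {poly S} => f`_r)).
  apply: eq_big_seq => p' p'P; congr (_ * _).
  rewrite raddf_sum /=; apply: eq_big_seq => nu nuP; rewrite /G.
  have [mp' sp'] := vstrips_path mp p'P.
  have [-> _ _] := tri_str mp' mu (etrans sp' pu) nuP.
  by rewrite (negPf (lab01 _)).
rewrite coef_sum; apply: eq_big_seq => nu nuP.
have [nuE mnu _] := tri_str mp mu pu nuP.
rewrite -coefE // [in LHS]nuE.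
rewrite lin0_str //; last by rewrite /G => t ->.
apply: (congr1 (fun f : {poly S} => f`_r)); apply: eq_big_seq => q qP; congr (_ * _).
rewrite /G (negPf (lab01 _)) unlab_lab parts_str //.
by case: (vstrips_path mnu qP).
Qed.

(** * Forced puzzles: the unit and padding by zeros *)

Lemma strip_cons l l' la c b : strip (l :: l' :: la) c b =
  gather (fun z => gather (fun y => gather (fun m =>
    if piece l z c && piece y m z then [seq m :: r | r <- strip (l' :: la) y b]
    else [::]))).
Proof. by []. Qed.

Lemma strip_ones k c b : b != L10 ->
  strip (nseq k.+1 L1) c b =
  nseq (c == if b == L1 then L1 else L10) (nseq k L1).
Proof.
elim: k c => [|k IH] c b01; first by case: b c b01 => -[].
rewrite [nseq k.+2 _]/= strip_cons /gather -/(nseq k.+1 L1) !IH //.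
by case: b c b01 {IH} => -[].
Qed.

Lemma strip_unit1 m k c : (0 < k)%N ->
  strip (nseq m L0 ++ nseq k L1) c L1 =
  nseq (c == L1) (nseq m L0 ++ nseq k.-1 L1).
Proof.
case: k => // k _; elim: m c => [|m IH] c; first by rewrite strip_ones.
case E: (nseq m L0 ++ nseq k.+1 L1) => [|l la].
  by move/(congr1 size): E; rewrite size_cat /= addnS.
by rewrite [nseq m.+1 _]/= cat_cons E strip_cons /gather -E !IH; case: c.
Qed.

Lemma strip_unit0 m k c :
  strip (nseq m.+1 L0 ++ nseq k L1) c L0 =
  nseq (c == L0) (nseq m L0 ++ nseq k L1).
Proof.
elim: m c => [|m IH] c.
  case: k => [|k]; first by case: c.
  by rewrite [nseq 1 _ ++ _]/= strip_cons /gather -/(nseq k.+1 L1) !strip_ones //; case: c.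
by rewrite [nseq m.+2 _]/= cat_cons cat_cons strip_cons /gather -cat_cons -/(nseq m.+1 L0) !IH;
  case: c.
Qed.

(** The sorted string belongs to the empty partition. Each strip removes from it the label found on
    the North-East side and repeats this label at the bottom. *)
Lemma tri_unit m k u : size u = (m + k)%N -> count id u = k ->
  tri (nseq m L0 ++ nseq k L1) (lab u) = [:: lab u].
Proof.
elim: u m k => //= -[] u IH m k su cu.
  case: k su cu => // k; rewrite addnS add1n => -[su] [cu].
  by rewrite /gather !strip_unit1 //= cats0 IH.
case: m su => [|m].
  rewrite add0n => su; move: (count_size id u).
  by rewrite -cu in su *; rewrite -[X in (X <= _)%N]su ltnn.
by rewrite addSn => -[su]; rewrite /gather !strip_unit0 /= !cats0 IH.
Qed.

Lemma strip0 l la c b : (forall z, ~~ piece l z c) -> strip (l :: la) c b = [::].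
Proof.
by case: la => [|l' la] lc; rewrite ?strip_cons /= /gather !(negPf (lc _)).
Qed.

(** A 0 at the top moves all labels down by one position. Padding uses b = false; the induction
    along the strip passes through both values. *)
Lemma strip_shift b s :
  strip (lab (b :: s)) (if b then L10 else L0) L0 = [:: lab s].
Proof.
elim: s b => [|b' s IH] b; first by case: b.
rewrite [lab _]/= strip_cons /gather; have := IH b'; rewrite [lab (b' :: s)]/= => {}IH.
have s01 : strip (L1 :: lab s) L0 L0 = [::] by apply: strip0; case.
have s10 : strip (L0 :: lab s) L10 L0 = [::] by apply: strip0; case.
by move: s01 s10 => /= s01 s10; case: b b' IH => -[] /= ->; rewrite ?s01 ?s10.
Qed.

(** * Puzzle numbers of partitions *)

Definition puz (m : nat) (p u q : seq nat) : nat :=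
  count_mem (lab (str m q)) (tri (lab (str m p)) (lab (str m u))).

(** A 0 in front of all three sides adds one strip, which is forced by [strip_shift]. Hence m can be
    enlarged until no vertical strip is cut off. *)
Lemma puz_pad m p u q : path geq m p -> path geq m u -> path geq m q ->
  puz m.+1 p u q = puz m p u q.
Proof.
move=> mp mu mq; rewrite /puz !strS // -!sum1_count big_mkcond sum_tri big_label.
rewrite [\sum_(r <- strip _ L1 _) _]big1_seq => [|r _]; last by rewrite big1.
rewrite [\sum_(r <- strip _ L10 _) _]big1_seq => [|r _]; last by rewrite big1.
by rewrite (strip_shift false) big_seq1 !addr0 [RHS]big_mkcond.
Qed.

Lemma str_zeros m k : lab (str m (nseq k 0%N)) = nseq m L0 ++ nseq k L1.
Proof.
elim: k m => [|k IH] m /=; first by rewrite /lab map_nseq cats0.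
by rewrite /lab map_cat map_nseq subn0 /= -/(lab _) IH.
Qed.

(** * Gelfand-Tsetlin sums and the dual Pieri rule *)

Section InterSum.
Variables (R : comNzRingType) (y : R).

(* The sum over all ka interlacing with la, of size one less, of
   y^(|la| - |ka|) F ka. *)
Fixpoint inter_sum (la : seq nat) (F : seq nat -> R) : R :=
  if la is l :: la' then
    if la' is l' :: _ then
      \sum_(l' <= a < l.+1) y ^+ (l - a) * inter_sum la' (fun q => F (a :: q))
    else y ^+ l * F [::]
  else 0.

Definition vsum (t : R) (m : nat) (la : seq nat) (F : seq nat -> R) : R :=
  \sum_(q <- vstrips m la) t ^+ (sumn q - sumn la) * F q.

Lemma vsum_cons t m l la F : path geq l la ->
  vsum t m (l :: la) F = vsum t l la (fun q => F (l :: q)) +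
    (if (l < m)%N then t * vsum t l.+1 la (fun q => F (l.+1 :: q)) else 0).
Proof.
move=> lla; rewrite /vsum /= big_cat /= big_map; congr (_ + _).
  by apply: eq_bigr => q _; rewrite /= subnDl.
case: ifP => _; last by rewrite big_nil.
rewrite big_map mulr_sumr; apply: eq_big_seq => q qP.
have lla' : path geq l.+1 la by case: la lla {F qP} => //= a s /andP[/leqW->].
by rewrite mulrA -exprS /= addSn subSn ?subnDl // leq_add2l (vstrips_sumn lla').
Qed.

Lemma vsum_nil t m F : vsum t m [::] F = F [::].
Proof. by rewrite /vsum big_seq1 expr0 mul1r. Qed.

Lemma vsum_sum t m la (I : Type) (s : seq I) F :
  vsum t m la (fun q => \sum_(i <- s) F i q) = \sum_(i <- s) vsum t m la (F i).
Proof.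
by rewrite exchange_big /=; apply: eq_bigr => p _; rewrite mulr_sumr.
Qed.

Lemma vsum_mul t m la a F : vsum t m la (fun q => a * F q) = a * vsum t m la F.
Proof. by rewrite mulr_sumr; apply: eq_bigr => p _; rewrite mulrCA. Qed.

Lemma eq_vsum t m la F G : F =1 G -> vsum t m la F = vsum t m la G.
Proof. by move=> FG; apply: eq_bigr => q _; rewrite FG. Qed.

Lemma vsum_large t m n la F : (head 0%N la < m)%N -> (head 0%N la < n)%N ->
  vsum t m la F = vsum t n la F.
Proof. by case: la => [|l la] //= lm ln; rewrite /vsum /= lm ln. Qed.

Lemma inter_sum_cons l l' la F : inter_sum (l :: l' :: la) F =
  \sum_(l' <= a < l.+1) y ^+ (l - a) * inter_sum (l' :: la) (fun q => F (a :: q)).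
Proof. by []. Qed.

Lemma eq_inter_sum l la F G : path geq l la ->
  (forall q, path geq l q -> size q = size la -> F q = G q) ->
  inter_sum (l :: la) F = inter_sum (l :: la) G.
Proof.
elim: la l F G => [|l' la IH] l F G; first by move=> _ FG /=; rewrite FG.
move=> /andP[ll' l'la] FG; rewrite !inter_sum_cons; apply: eq_big_nat => a /andP[la1 la2].
congr (_ * _); apply: IH => // q qa sq; apply: FG; rewrite /= ?sq // -ltnS la2 /=.
by case: q qa {sq} => //= b q /andP[bl ->]; rewrite (leq_trans bl).
Qed.

Lemma inter_sumD l la F G :
  inter_sum (l :: la) (fun q => F q + G q) = inter_sum (l :: la) F + inter_sum (l :: la) G.
Proof.
elim: la l F G => [|l' la IH] l F G; first by rewrite /= mulrDr.
rewrite !inter_sum_cons -big_split; apply: eq_bigr => a _.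
by rewrite (IH _ (fun q => F (a :: q)) (fun q => G (a :: q))) mulrDr.
Qed.

Lemma inter_sumM l la a F :
  inter_sum (l :: la) (fun q => a * F q) = a * inter_sum (l :: la) F.
Proof.
elim: la l F => [|l' la IH] l F; first by rewrite /= mulrCA.
by rewrite !inter_sum_cons mulr_sumr; apply: eq_bigr => b _;
  rewrite (IH _ (fun q => F (b :: q))) mulrCA.
Qed.

(* Both parts are needed for the induction: in the first one, the strip on the
   right does not meet the first entry l of the outer partition. *)
Lemma inter_vsum t l la F : path geq l la ->
  vsum t l la (fun q => inter_sum (l :: q) F) =
    inter_sum (l :: la) (fun q => vsum t l q F) /\
  forall m, (l < m)%N ->
    vsum t l la (fun q => inter_sum (l :: q) F) +
    t * vsum t l.+1 la (fun q => inter_sum (l.+1 :: q) F) =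
    (1 + t * y) * inter_sum (l :: la) (fun q => vsum t m q F).
Proof.
elim: la l F => [|l' la IH] l F.
  by move=> _; rewrite !vsum_nil /= vsum_nil; split=> // m _; rewrite vsum_nil exprS; ring.
move=> /andP[ll' l'la].
(* [J] and [I] are the two orders of summation for the tail, once the first entry b of the inner
   partition is fixed. The induction hypothesis relates them; [JE] and [IE] expand both sides of the
   claim in them. *)
pose J k b := vsum t k la (fun q => inter_sum (k :: q) (fun q => F (b :: q))).
pose I m b := inter_sum (l' :: la) (fun q => vsum t m q (fun q => F (b :: q))).
have IH1 b : J l' b = I l' b by apply: (IH l' _ l'la).1.
have IH2 m b : (l' < m)%N -> J l' b + t * J l'.+1 b = (1 + t * y) * I m b.
  by move=> lm; apply: (IH l' _ l'la).2.
have JE k : (l' <= k)%N -> vsum t k (l' :: la) (fun q => inter_sum (k :: q) F) =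
    \sum_(l' <= b < k.+1) y ^+ (k - b) * J l' b +
    t * \sum_(l'.+1 <= b < k.+1) y ^+ (k - b) * J l'.+1 b.
  move=> lk; rewrite vsum_cons //.
  have vE c : vsum t c la (fun q => inter_sum [:: k, c & q] F) =
      \sum_(c <= b < k.+1) y ^+ (k - b) * J c b.
    rewrite (eq_vsum _ _ _ (fun q => inter_sum_cons k c q F)) vsum_sum.
    by apply: eq_bigr => b _; rewrite vsum_mul.
  rewrite !vE; case: ltnP => // kl; rewrite [in RHS](big_geq (m := l'.+1)) //.
  by rewrite mulr0.
have IE m : (l <= m)%N -> inter_sum [:: l, l' & la] (fun q => vsum t m q F) =
    \sum_(l' <= a < l.+1) y ^+ (l - a) * I a a +
    t * \sum_(l' <= a < l.+1 | (a < m)%N) y ^+ (l - a) * I a.+1 a.+1.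
  move=> lm; rewrite inter_sum_cons [X in t * X]big_mkcond mulr_sumr -big_split.
  apply: eq_big_nat => a /andP[la1 la2].
  have -> : inter_sum (l' :: la) (fun q => vsum t m (a :: q) F) =
    I a a + (if (a < m)%N then t * I a.+1 a.+1 else 0).
    rewrite (@eq_inter_sum _ _ _ (fun q =>
      vsum t a q (fun q => F (a :: q)) + (if (a < m)%N then 1 else 0) *
      (t * vsum t a.+1 q (fun q => F (a.+1 :: q))))) //.
      rewrite inter_sumD !inter_sumM; case: ifP; rewrite ?mul1r ?mul0r //.
    move=> q ql _; rewrite vsum_cons; first by case: ifP; rewrite ?mul1r ?mul0r.
    by case: q ql => //= c q /andP[cl ->]; rewrite (leq_trans cl).
  by rewrite mulrDr; congr (_ + _); case: ifP => _; rewrite ?mulr0 // mulrCA.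
have IS m b : (l' < m)%N -> I m b = I l'.+1 b.
  move=> lm; apply: eq_inter_sum => // q lq _; apply: vsum_large.
    by apply: leq_ltn_trans lm; case: q lq => //= c q /andP[].
  by rewrite ltnS; case: q lq => //= c q /andP[].
have JI : vsum t l (l' :: la) (fun q => inter_sum (l :: q) F) =
    inter_sum [:: l, l' & la] (fun q => vsum t l q F).
  have shift : \sum_(l' <= a < l.+1 | (a < l)%N) y ^+ (l - a) * I a.+1 a.+1 =
      y * \sum_(l'.+1 <= b < l.+1) y ^+ (l - b) * I l'.+1 b.
    rewrite -(big_nat_widen l' l l.+1 xpredT) //= big_add1 /= mulr_sumr.
    apply: eq_big_nat => a /andP[la1 la2].
    by rewrite -(IS a.+1) ?ltnS // mulrA -exprS subnSK.
  rewrite JE // IE // shift big_ltn ?ltnS // [in RHS]big_ltn ?ltnS // IH1 -!addrA.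
  congr (_ + _).
  transitivity (\sum_(l'.+1 <= b < l.+1) (1 + t * y) * (y ^+ (l - b) * I l'.+1 b)).
    rewrite mulr_sumr -big_split; apply: eq_bigr => b _ /=.
    by rewrite mulrCA -mulrDr (IH2 l'.+1) // mulrCA.
  rewrite -mulr_sumr mulrDl mul1r -mulrA; congr (_ + _).
  by apply: eq_big_nat => a /andP[la1 la2]; rewrite -(IS a).
split=> // m lm.
have -> : inter_sum [:: l, l' & la] (fun q => vsum t m q F) =
    inter_sum [:: l, l' & la] (fun q => vsum t l q F) + t * I l.+1 l.+1.
  rewrite !IE //; last exact: ltnW.
  rewrite -addrA -mulrDr; congr (_ + t * _).
  rewrite -(big_nat_widen l' l l.+1 xpredT) //=.
  transitivity (\sum_(l' <= a < l.+1) y ^+ (l - a) * I a.+1 a.+1).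
    rewrite !big_mkcond; apply: eq_big_nat => a /andP[_ al].
    by rewrite (leq_trans al).
  by rewrite big_nat_recr //= subnn mul1r.
have -> : vsum t l.+1 (l' :: la) (fun q => inter_sum (l.+1 :: q) F) =
    y * vsum t l (l' :: la) (fun q => inter_sum (l :: q) F) + (1 + t * y) * I l.+1 l.+1.
  rewrite !JE //; last exact: leqW.
  rewrite -(IH2 _ l.+1) // [in LHS]big_nat_recr ?leqW //=.
  rewrite [\sum_(_.+1 <= _ < _.+2) _]big_nat_recr //=.
  rewrite subnn !mul1r !mulrDr addrACA; congr (_ + _).
  rewrite mulrCA !mulr_sumr; congr (_ + _).
    apply: eq_big_nat => b /andP[_ bl]; rewrite mulrA -exprS subSn //.
  by apply: eq_big_nat => b /andP[_ bl]; rewrite subSn // exprS; ring.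
rewrite -JI; ring.
Qed.
End InterSum.

Lemma eq_inter_sum_size (R : comNzRingType) (y : R) l la F G :
  (forall q, size q = size la -> F q = G q) ->
  inter_sum y (l :: la) F = inter_sum y (l :: la) G.
Proof.
elim: la l F G => [|l' la IH] l F G FG; first by rewrite /= FG.
rewrite !inter_sum_cons; apply: eq_bigr => a _.
by congr (_ * _); apply: IH => q sq; apply: FG; rewrite /= sq.
Qed.

Lemma inter_sum_zeros (R : comNzRingType) (y : R) k F :
  inter_sum y (nseq k.+1 0%N) F = F (nseq k 0%N).
Proof.
elim: k F => [|k IH] F; first by rewrite /= mul1r.
by rewrite [nseq k.+2 _]/= inter_sum_cons big_nat1 mul1r (IH (fun q => F (0%N :: q))).
Qed.

Lemma inter_sum_map (R S : comNzRingType) (f : {rmorphism R -> S}) y la F :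
  f (inter_sum y la F) = inter_sum (f y) la (fun q => f (F q)).
Proof.
elim: la F => [|l [|l' la] IH] F; first exact: rmorph0.
  by rewrite /= rmorphM rmorphXn.
rewrite !inter_sum_cons rmorph_sum; apply: eq_bigr => a _.
by rewrite rmorphM rmorphXn IH.
Qed.

(* The Schur polynomial of la in x_0, .., x_(k-1), la having size k. *)
Fixpoint gt (R : comNzRingType) (x : nat -> R) (k : nat) (la : seq nat) : R :=
  if k is k'.+1 then inter_sum (x k') la (gt x k') else 1.

Lemma gt_map (R S : comNzRingType) (f : {rmorphism R -> S}) x k la :
  size la = k -> f (gt x k la) = gt (f \o x) k la.
Proof.
elim: k la => [|k IH] la; first by move=> _; exact: rmorph1.
case: la => // l la [sla]; rewrite /= -/(inter_sum _ (l :: la) _) inter_sum_map.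
by apply: eq_inter_sum_size => q sq; rewrite IH ?sq.
Qed.

Section GT.
Variables (R : comNzRingType) (x : nat -> R).

(** Moving the strip past the sum over interlacing partitions yields the factor 1 + t x_i of one
    variable at a time. With the first part below m, no strip is cut off. *)
Lemma gt_vsum t k la m : size la = k -> sorted geq la -> (head 0%N la < m)%N ->
  (\prod_(i < k) (1 + t * x i)) * gt x k la = vsum t m la (gt x k).
Proof.
elim: k la m => [|k IH] la m.
  by move/size0nil->; rewrite big_ord0 vsum_nil mul1r.
case: la => // l la [sla] /= lla lm.
rewrite big_ord_recr /= mulrAC mulrC -/(inter_sum _ (l :: la) _) -inter_sumM.
rewrite (@eq_inter_sum _ _ _ _ _ (fun q => vsum t m q (gt x k))) //; last first.
  move=> q lq sq; apply: IH; first by rewrite sq.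
    exact: path_sorted lq.
  by apply: leq_ltn_trans lm; case: q lq {sq} => //= a q /andP[].
rewrite -(inter_vsum _ _ _ lla).2 // vsum_cons // lm.
by [].
Qed.

End GT.

Lemma gt_zeros (R : comNzRingType) (x : nat -> R) k : gt x k (nseq k 0%N) = 1.
Proof.
by elim: k => [|k IH] //; rewrite [gt _ _ _]inter_sum_zeros.
Qed.

(** Here e is the elementary symmetric polynomial of degree r, obtained as the coefficient of t^r in
    the product of the 1 + t x_i; the quantifiers say that it is the same for all la. *)
Lemma gt_pieri (R : comNzRingType) (x : nat -> R) k r : exists e : R, forall la m,
  size la = k -> sorted geq la -> (head 0%N la < m)%N ->
  e * gt x k la = \sum_(q <- vstrips m la | sumn q == (sumn la + r)%N) gt x k q.
Proof.
pose X i := (x i)%:P; exists (\prod_(i < k) (1 + 'X * X i))`_r => la m sla sorted_la lam.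
have := gt_vsum X 'X sla sorted_la lam.
have gtX q : size q = k -> gt X k q = (gt x k q)%:P.
  by move=> sq; rewrite -(gt_map polyC x sq).
move/(congr1 (fun f : {poly R} => f`_r)); rewrite gtX // coefMC => ->.
have mla : path geq m la by case: la sorted_la lam {sla} => //= l la ->; rewrite andbT => /ltnW.
rewrite coef_sum [RHS]big_mkcond; apply: eq_big_seq => q qP.
have [mq sq] := vstrips_path mla qP.
rewrite gtX ?sq // coefMC coefXn; have qq := vstrips_sumn mla qP.
have -> : (r == sumn q - sumn la)%N = (sumn q == sumn la + r)%N.
  by rewrite -{2}(subnKC qq) eqn_add2l eq_sym.
by case: eqP; rewrite ?mul1r ?mul0r.
Qed.

Import Order.TTheory Num.Theory.

(** * Puzzles compute products of Schur polynomials *)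

(** The row weights k, k - 1, .., 1 decrease downwards. So among the vertical strips of a given
    size, the one in the top rows (see [incr]) is the only maximum; this replaces the dominance
    order. *)
Fixpoint wsum (p : seq nat) : nat :=
  if p is a :: p' then (size p * a + wsum p')%N else 0%N.

Fixpoint incr (d : nat) (p : seq nat) : seq nat :=
  match d, p with
  | d'.+1, a :: p' => a.+1 :: incr d' p'
  | _, _ => p
  end.

Arguments incr : simpl nomatch.

Lemma size_incr d p : size (incr d p) = size p.
Proof. by elim: p d => [|a p IH] [|d] //=; rewrite IH. Qed.

Lemma wsum_incrS d p : (wsum (incr d.+1 p) <= wsum (incr d p) + size p)%N.
Proof.
elim: p d => [|a p IH] [|d] //=; first by rewrite mulnS; lia.
by have := IH d; rewrite /= !size_incr; lia.
Qed.

Lemma vstrips_wsum m p q d : path geq m p -> q \in vstrips m p ->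
  sumn q = (sumn p + d)%N -> q = incr d p \/ (wsum q < wsum (incr d p))%N.
Proof.
elim: p m q d => [|a p IH] m q d.
  by move=> _; rewrite inE => /eqP-> _; left; case: d.
move=> /= /andP[am ap]; rewrite mem_cat => /orP[/mapP[r rp ->] /= rd|].
  have {}rd : sumn r = (sumn p + d)%N by lia.
  have [_ sr] := vstrips_path ap rp.
  case: (IH _ _ _ ap rp rd) => [->|lt].
    case: d {rd} => [|d]; first by left; case: (p).
    right; have := wsum_incrS d p; rewrite /= !size_incr; lia.
  right; case: d lt {rd} => [|d] lt.
    by move: lt; rewrite /= sr; case: (p) => //=; lia.
  have := wsum_incrS d p; rewrite /= sr !size_incr; lia.
case: ifP => // {}am /mapP[r rp ->] /= rd.
have {}ap : path geq a.+1 p by case: (p) ap => //= b s /andP[/leqW->].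
have [_ sr] := vstrips_path ap rp.
case: d rd => [|d] rd; first by have := vstrips_sumn ap rp; lia.
have {}rd : sumn r = (sumn p + d)%N by lia.
case: (IH _ _ _ ap rp rd) => [->|lt]; first by left.
by right; rewrite /= sr size_incr; lia.
Qed.

Lemma vstrips_refl m p : p \in vstrips m p.
Proof. by elim: p m => //= a p IH m; rewrite mem_cat map_f. Qed.

Lemma uniq_vstrips m p : uniq (vstrips m p).
Proof.
elim: p m => //= a p IH m; rewrite cat_uniq map_inj_uniq ?IH /= => [|? ? []] //.
case: ifP => // _; rewrite map_inj_uniq ?IH ?andbT => [|? ? []] //.
apply/hasPn => _ /mapP[r _ ->]; apply/mapP => -[t _ [/eqP]].
by rewrite eqn_leq ltnn.
Qed.

(* The partition s is p without its last column. *)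
Lemma remove_column c p : path geq c.+1 p ->
  exists s r, [/\ path geq c s, size s = (size p).+1, c.+1 :: p = incr r s,
    (forall m, (c < m)%N -> c.+1 :: p \in vstrips m s) &
    (sumn s + r = sumn (c.+1 :: p))%N /\ (wsum s < wsum (c.+1 :: p))%N].
Proof.
elim: p => [|a p IH] /=.
  move=> _; exists [:: c], 1%N; split => //=; rewrite ?leqnn //; last by lia.
  by move=> m ->; rewrite !inE eqxx orbT.
case/andP=> ac; case: (eqVneq a c.+1) => [-> ap|a1 ap].
  have [s [r [cs ss sE sV [sr sw]]]] := IH ap.
  exists (c :: s), r.+1; split => /=; rewrite ?leqnn ?ss //.
  - by rewrite sE.
  - move=> m cm; rewrite /= cm mem_cat; apply/orP; right.
    by apply: map_f; apply: sV.
  - by move: sr sw => /=; lia.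
exists (c :: a :: p), 1%N; split => //=.
- by rewrite leqnn ap andbT -ltnS ltn_neqAle a1.
- move=> m cm; rewrite /= cm; rewrite mem_cat; apply/orP; right.
  by apply: map_f; apply: (vstrips_refl _ (a :: p)).
- by lia.
Qed.

Lemma path_zeros m p : path geq m p -> head 0%N p = 0%N -> p = nseq (size p) 0%N.
Proof.
case: p => //= a p /andP[_ ap] a0; move: ap; rewrite {}a0 => ap; congr (_ :: _).
elim: p ap => //= b p IH /andP[b0 bp]; have b00 : b = 0%N by lia.
by rewrite -IH // -?{1}b00.
Qed.

(** Induction on [wsum]: p is the leading strip over s, which is p without its last column, and the
    other strips q of the same size are smaller. A linear identity thus passes to p from s and these
    q. *)
Lemma partition_ind (P : seq nat -> Prop) k m :
  P (nseq k 0%N) ->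
  (forall s r p, path geq m s -> size s = k -> p \in vstrips m s ->
    sumn p = (sumn s + r)%N -> P s ->
    (forall q, q \in vstrips m s -> sumn q = (sumn s + r)%N -> q != p -> P q) -> P p) ->
  forall p, path geq m p -> size p = k -> P p.
Proof.
move=> P0 PS p; have [n] := ubnP (wsum p).
elim: n p => // n IH p /ltnSE pn mp sp.
case p0: (head 0%N p) => [|c].
  by rewrite (path_zeros mp p0) sp.
case: p p0 pn mp sp => //= a p -> pn /andP[cm cp] sp.
have [s [r [cs ss sE sV [sr sw]]]] := remove_column cp.
have ms : path geq m s.
  by case: (s) cs => //= b t /andP[bc ->]; rewrite andbT (leq_trans bc) // ltnW.
apply: (PS s r) => //; first by rewrite ss.
- exact: sV.
- by apply: IH => //; [apply: leq_trans sw _|rewrite ss].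
move=> q qs sq qp; have [mq sq'] := vstrips_path ms qs.
apply: IH => //; last by rewrite sq' ss.
case: (vstrips_wsum ms qs sq) => [qE|lt]; first by rewrite qE sE eqxx in qp.
by rewrite -sE in lt; apply: leq_trans lt _.
Qed.

(** Puzzles whose South side has the wrong size are counted. By commutation and the case of s, their
    total over all strips is zero; the terms are nonnegative, so the term of p vanishes too. *)
Lemma tri_sumn m p u nu : path geq m p -> path geq m u -> size p = size u ->
  nu \in tri (lab (str m p)) (lab (str m u)) -> sumn (unlab nu) = (sumn p + sumn u)%N.
Proof.
move=> mp mu pu; move: p mp pu nu; apply: partition_ind => [|s r p ms ss ps sp Ps _] nu.
  rewrite str_zeros tri_unit ?size_str ?count_str // inE => /eqP->.
  by rewrite unlab_lab parts_str // sumn_nseq mul0n add0n.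
move=> nuP; apply/eqP/contraT => nuB.
pose K q : int := (sumn q != (sumn p + sumn u)%N)%:R.
have K0 q : 0 <= K q by rewrite ler0n.
have := tri_vstrips r K ms mu ss.
rewrite (big_rem p ps) /= sp eqxx (big_rem nu nuP) /= {1}/K nuB [RHS]big1_seq => [e|t tP].
  suff : 0 < 0 :> int by rewrite ltxx.
  rewrite -[X in _ < X]e -addrA ltr_pwDl // addr_ge0 ?sumr_ge0 // => q _.
  by rewrite sumr_ge0.
have tE := Ps _ tP.
rewrite big1 // => q /eqP qE.
by rewrite /K qE tE sp addnAC eqxx.
Qed.

(** The bound on m leaves room for all strips added to s and to the South sides, so that [vstrips]
    gives the full Pieri sums. *)
Lemma gt_mul (R : comNzRingType) (x : nat -> R) m p u :
  path geq m p -> path geq m u -> size p = size u -> (sumn p + sumn u < m)%N ->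
  gt x (size u) p * gt x (size u) u =
  \sum_(nu <- tri (lab (str m p)) (lab (str m u))) gt x (size u) (unlab nu).
Proof.
move=> mp mu pu; set k := size u in pu *.
move: p mp pu; apply: partition_ind => [|s r p ms ss ps sp IHs IH] pum.
  rewrite str_zeros tri_unit ?size_str ?count_str // big_seq1 unlab_lab parts_str //.
  by rewrite gt_zeros mul1r.
have [e eP] := gt_pieri x k r.
have su : (sumn s + sumn u < m)%N by lia.
have vE q : path geq m q -> size q = k -> (sumn q < m)%N ->
    e * gt x k q = \sum_(t <- vstrips m q | sumn t == (sumn q + r)%N) gt x k t.
  move=> mq sq qm; apply: eP => //; first exact: path_sorted mq.
  by apply: leq_ltn_trans qm; case: (q) => //= a t; rewrite leq_addr.
have := congr1 ( *%R e) (IHs su).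
rewrite mulrA vE ?(leq_ltn_trans _ su) ?leq_addr // mulr_suml.
have -> : e * \sum_(nu <- tri (lab (str m s)) (lab (str m u))) gt x k (unlab nu) =
    \sum_(q <- vstrips m s | sumn q == (sumn s + r)%N)
      \sum_(nu <- tri (lab (str m q)) (lab (str m u))) gt x k (unlab nu).
  rewrite tri_vstrips // mulr_sumr; apply: eq_big_seq => nu nuP.
  have [_ mnu snu] := tri_str ms mu ss nuP.
  by rewrite vE ?snu // (tri_sumn ms mu ss nuP).
(* The summands other than that of p agree by induction and cancel. *)
rewrite !(big_rem p ps) /= sp eqxx.
set A := \sum_(_ <- rem _ _ | _) _; set B := \sum_(_ <- rem _ _ | _) _.
suff -> : A = B by move/addIr.
rewrite /A /B [LHS]big_seq_cond [RHS]big_seq_cond; apply: eq_bigr => q /andP[qP /eqP qE].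
apply: IH => //; last by rewrite qE -sp.
  exact: mem_rem qP.
by move: qP; rewrite mem_rem_uniq ?uniq_vstrips // inE => /andP[].
Qed.

(** * Tableaux *)

Fixpoint inter (la : seq nat) : seq (seq nat) :=
  if la is l :: la' then
    if la' is l' :: _ then
      flatten [seq [seq a :: q | q <- inter la'] | a <- index_iota l' l.+1]
    else [:: [::]]
  else [::].

Lemma inter_cons l l' la : inter (l :: l' :: la) =
  flatten [seq [seq a :: q | q <- inter (l' :: la)] | a <- index_iota l' l.+1].
Proof. by []. Qed.

Lemma uniq_inter la : uniq (inter la).
Proof.
elim: la => [|l [|l' la] IH] //; rewrite inter_cons.
by apply: allpairs_uniq => [||[a q] [b r] _ _ [-> ->]] //; apply: iota_uniq.
Qed.

Lemma interP l la q : reflect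
  (size q = size la /\ forall i, (i < size la)%N ->
    (nth 0%N la i <= nth 0%N q i <= nth 0%N (l :: la) i)%N)
  (q \in inter (l :: la)).
Proof.
elim: la l q => [|l' la IH] l q.
  by rewrite inE; apply: (iffP eqP) => [->|[/size0nil]].
rewrite inter_cons; apply: (iffP allpairsP) => [[[a r] [/= aP /IH[sr rP] ->]]|].
  rewrite /= sr; split=> // -[|i] /= il; last exact: rP.
  by move: aP; rewrite mem_index_iota ltnS.
case: q => [|a q] [] //= [sq] qP; exists (a, q); split=> //=.
  by have := qP 0%N isT; rewrite mem_index_iota ltnS.
by apply/IH; split=> // i il; apply: (qP i.+1).
Qed.

Lemma inter_sumn la q : q \in inter la -> (sumn q <= sumn la)%N.
Proof.
elim: la q => // l [|l' la] IH q; first by rewrite inE => /eqP->.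
rewrite inter_cons => /allpairsP[[a r] [aP rP ->]].
have := IH r rP; move: aP; rewrite mem_index_iota ltnS /=; lia.
Qed.

Lemma inter_sumE (R : comNzRingType) (y : R) la F :
  inter_sum y la F = \sum_(q <- inter la) y ^+ (sumn la - sumn q) * F q.
Proof.
elim: la F => [|l [|l' la] IH] F; first by rewrite big_nil.
  by rewrite big_seq1 /= addn0 subn0.
rewrite inter_sum_cons inter_cons big_flatten big_map.
apply: eq_big_seq => a; rewrite mem_index_iota ltnS => /andP[_ al].
rewrite big_map (IH (fun q => F (a :: q))) mulr_sumr; apply: eq_big_seq => q qP.
have := inter_sumn qP; rewrite mulrA -exprD /= => qs; congr (_ ^+ _ * _).
by lia.
Qed.

Section Cells.
Variables (T : Type) (d : T).

(** The type of cells depends on the shape; reading a filling at two natural numbers makes fillings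
    of different shapes comparable. *)
Definition at_cell la (f : {ffun cell la -> T}) (i j : nat) : T :=
  if [pick c | (cell_row c == i) && (cell_col c == j)] is Some c then f c else d.

Lemma cell_inj la (c c' : cell la) :
  cell_row c = cell_row c' -> cell_col c = cell_col c' -> c = c'.
Proof.
case: c c' => [i j] [i' j'] ri; have ii' : i = i' by apply: val_inj.
by case: i' / ii' j' {ri} => j' ci; congr existT; apply: val_inj.
Qed.

Lemma at_cellE la (f : {ffun cell la -> T}) c : at_cell f (cell_row c) (cell_col c) = f c.
Proof.
rewrite /at_cell; case: pickP => [c' /andP[/eqP r /eqP l]|/(_ c)].
  by rewrite (cell_inj r l).
by rewrite !eqxx.
Qed.

Lemma cellP la i j : (j < nth 0%N la i)%N ->
  exists c : cell la, cell_row c = i /\ cell_col c = j.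
Proof.
move=> ji; have il : (i < size la)%N.
  by rewrite ltnNge; apply: contraL ji => il; rewrite nth_default.
by exists (existT (fun i : 'I_(size la) => 'I_(nth 0%N la i)) (Ordinal il) (Ordinal ji)).
Qed.

Lemma cell_lt la (c : cell la) : (cell_col c < nth 0%N la (cell_row c))%N.
Proof. exact: ltn_ord. Qed.

End Cells.

Lemma big_cell (R : Type) (idx : R) (op : Monoid.com_law idx) la (G : nat -> nat -> R) :
  \big[op/idx]_(c : cell la) G (cell_row c) (cell_col c) =
  \big[op/idx]_(i < size la) \big[op/idx]_(j < nth 0%N la i) G i j.
Proof.
by rewrite (sig_big_dep (fun=> true) (fun _ _ => true)
  (fun (i : 'I_(size la)) (j : 'I_(nth 0%N la i)) => G i j)).
Qed.

Lemma sorted_nth la i j : sorted geq la -> (i <= j)%N -> (nth 0%N la j <= nth 0%N la i)%N.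
Proof.
move=> la_sorted ij; case: (ltnP j (size la)) => jl; last by rewrite nth_default.
apply: (sorted_leq_nth (leT := geq)) => //; first by move=> ? ? ? ? /leq_trans; apply.
  by move=> n; apply: leqnn.
by rewrite inE (leq_ltn_trans ij).
Qed.

Lemma inter_sorted l la q : path geq l la -> q \in inter (l :: la) ->
  sorted geq q /\ size q = size la.
Proof.
move=> lla /interP[sq qP]; split=> //; apply/(sortedP 0%N) => i iq.
have /andP[_ le1] := qP i.+1 (etrans (esym (congr1 (leq i.+2) sq)) iq).
have /andP[le2 _] := qP i (etrans (esym (congr1 (leq i.+1) sq)) (ltnW iq)).
exact: leq_trans le1 le2.
Qed.

(** A set of indices closed downwards is an initial segment, determined by its size. Applied to a
    row, it turns the entries less than k into a row length. *)
Lemma count_initial (p : pred nat) n j :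
  (forall i i', (i < i')%N -> (i' < n)%N -> p i' -> p i) ->
  (j < n)%N -> p j = (j < count p (iota 0 n))%N.
Proof.
elim: n => // n IH pP; rewrite ltnS leq_eqVlt -[in iota _ _]addn1 iotaD count_cat /= add0n addn0.
have pP' i i' : (i < i')%N -> (i' < n)%N -> p i' -> p i.
  by move=> ii' i'n; apply: pP => //; apply: ltnW.
case/predU1P=> [->|jn].
  case pn: (p n); last first.
    by rewrite addn0 ltnNge (leq_trans (count_size _ _)) ?size_iota.
  suff -> : count p (iota 0 n) = n by rewrite addn1 ltnSn.
  apply/eqP; rewrite -{2}(size_iota 0 n) -all_count; apply/allP => i.
  by rewrite mem_iota => /andP[_ iN]; apply: (pP i n).
rewrite IH //; case pn: (p n); rewrite ?addn0 // addn1.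
have -> : count p (iota 0 n) = n.
  apply/eqP; rewrite -{2}(size_iota 0 n) -all_count; apply/allP => i.
  by rewrite mem_iota => /andP[_ iN]; apply: (pP i n).
by rewrite jn ltnW.
Qed.

Lemma sumn_nth s : sumn s = (\sum_(i < size s) nth 0 s i)%N.
Proof. by rewrite sumnE (big_nth 0%N) big_mkord. Qed.

Section Branching.
Variables (K : nat) (R : comNzRingType) (x : nat -> R).

Definition tv la (T : {ffun cell la -> 'I_K.+1}) (i j : nat) : nat := at_cell ord0 T i j.

Lemma tvE la (T : {ffun cell la -> 'I_K.+1}) c : tv T (cell_row c) (cell_col c) = T c.
Proof. by rewrite /tv at_cellE. Qed.

(** The alphabet is fixed and only the bound k varies, so that the induction on k stays within one
    family of types. *)
Definition ssyt k la (T : {ffun cell la -> 'I_K.+1}) :=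
  semistandard T && [forall c, (T c < k)%N].

Definition ssyt_sum k la :=
  \sum_(T : {ffun cell la -> 'I_K.+1} | ssyt k T) \prod_(c : cell la) x (T c).

Lemma ssytP k la (T : {ffun cell la -> 'I_K.+1}) : reflect
  [/\ forall i j j', (j < j')%N -> (j' < nth 0 la i)%N -> (tv T i j <= tv T i j')%N,
      forall i i' j, (i < i')%N -> (j < nth 0 la i)%N -> (j < nth 0 la i')%N ->
        (tv T i j < tv T i' j)%N
    & forall i j, (j < nth 0 la i)%N -> (tv T i j < k)%N] (ssyt k T).
Proof.
apply: (iffP andP) => [[/forallP ss /forallP Tk]|[row col Tk]].
  split.
  - move=> i j j' jj' j'l; have [c' [c'r c'j]] := cellP j'l.
    have [c [cr cj]] := cellP (ltn_trans jj' j'l).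
    have /andP[le _] := forallP (ss c) c'; move: le.
    by rewrite -!tvE cr c'r cj c'j eqxx jj'.
  - move=> i i' j ii' jl jl'; have [c' [ci' cj']] := cellP jl'.
    have [c [ci cj]] := cellP jl.
    have /andP[_] := forallP (ss c) c'.
    by rewrite -!tvE ci cj cj' ci' eqxx ii'.
  - by move=> i j jl; have [c [<- <-]] := cellP jl; rewrite tvE.
split; apply/forallP => c; last by rewrite -tvE; apply: Tk; apply: cell_lt.
apply/forallP => c'; rewrite -!tvE; apply/andP; split; apply/implyP => /andP[/eqP e lt].
  by rewrite e; apply: row => //; apply: cell_lt.
by rewrite e; apply: col => //; first rewrite -e; apply: cell_lt.
Qed.

Definition bounded_by k la (ka : seq nat) (T : {ffun cell la -> 'I_K.+1}) :=
  [forall c : cell la, (T c < k)%N == (cell_col c < nth 0 ka (cell_row c))%N].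

Lemma bounded_byP k la ka (T : {ffun cell la -> 'I_K.+1}) : reflect
  (forall i j, (j < nth 0 la i)%N -> (tv T i j < k)%N = (j < nth 0 ka i)%N)
  (bounded_by k ka T).
Proof.
apply: (iffP forallP) => [TP i j jl|TP c]; last by rewrite -tvE TP ?cell_lt.
by have [c [<- <-]] := cellP jl; rewrite tvE (eqP (TP c)).
Qed.

(** The entries less than k fill exactly one shape. It interlaces with l :: la: a cell above another
    cell has an entry less than k, as the lower entry is at most k. The equation serves to insert
    the sum over shapes at each tableau. *)
Lemma bounded_by_unique k l la (T : {ffun cell (l :: la) -> 'I_K.+1}) (V : nmodType) (v : V) :
  path geq l la -> size la = k -> ssyt k.+1 T ->
  v = \sum_(ka <- inter (l :: la)) (if bounded_by k ka T then v else 0).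
Proof.
move=> lla sla /ssytP[row col Tk].
have la_sorted : sorted geq (l :: la) by [].
pose p i j := (tv T i j < k)%N.
pose ka0 := mkseq (fun i => count (p i) (iota 0 (nth 0%N (l :: la) i))) k.
have pE i j : (j < nth 0%N (l :: la) i)%N ->
    p i j = (j < count (p i) (iota 0 (nth 0%N (l :: la) i)))%N.
  apply: count_initial => j1 j2 jj j2l; rewrite /p => /(leq_ltn_trans _); apply.
  exact: row.
have B0 : bounded_by k ka0 T.
  apply/bounded_byP => i j jl; case: (ltnP i k) => ik; first by rewrite nth_mkseq // -pE.
  rewrite nth_default ?size_mkseq // ltn0; apply/negbTE; rewrite -leqNgt.
  have {ik} : (k <= i)%N by []. 
  (* By strictness of columns, row i contains only entries at least i; hence row k contains none
     less than k. *)
  suff ti : (i <= tv T i j)%N by move/leq_trans; apply.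
  elim: i jl => // i IH jl; apply: leq_ltn_trans (col i i.+1 j _ _ _) => //.
    by apply: IH; apply: leq_trans jl _; apply: sorted_nth.
  by apply: leq_trans jl _; apply: sorted_nth.
have in0 : ka0 \in inter (l :: la).
  apply/interP; rewrite size_mkseq sla; split=> // i ik.
  rewrite nth_mkseq //; apply/andP; split; last first.
    by rewrite (leq_trans (count_size _ _)) // size_iota.
  rewrite leqNgt; apply/negP => lt.
  have := pE i _ (leq_trans lt (sorted_nth (i := i) (j := i.+1) la_sorted _)).
  move/(_ (leqnSn _)); rewrite ltnn => /negP; apply.
  apply: leq_trans (col i i.+1 _ _ _ _) _ => //.
    by apply: leq_trans lt (sorted_nth (i := i) (j := i.+1) la_sorted _).
  exact: Tk.
rewrite (bigD1_seq ka0) ?uniq_inter //= B0 big1_seq ?addr0 // => ka /andP[ne inka].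
case: ifP => // /bounded_byP B; case/eqP: ne.
have /interP[ska kaP] := inka; apply: (@eq_from_nth _ 0%N); rewrite ?size_mkseq ?ska //.
move=> i; rewrite sla => ik; rewrite nth_mkseq //.
have le1 : (nth 0 ka i <= nth 0 (l :: la) i)%N.
  by have /andP[] := kaP i (etrans (congr1 (leq i.+1) sla) ik).
have le2 := count_size (p i) (iota 0 (nth 0%N (l :: la) i)); rewrite size_iota in le2.
apply/eqP; rewrite eqn_leq; apply/andP; split; rewrite leqNgt; apply/negP => lt.
  have jl := leq_trans lt le1.
  by have := pE i _ jl; rewrite /p B // lt ltnn.
have jl := leq_trans lt le2.
by have := pE i _ jl; rewrite /p B // lt ltnn.
Qed.
Definition extend k la ka (T : {ffun cell ka -> 'I_K.+1}) : {ffun cell la -> 'I_K.+1} :=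
  [ffun c : cell la => if (cell_col c < nth 0 ka (cell_row c))%N
    then at_cell ord0 T (cell_row c) (cell_col c) else inord k].

Definition restrict la ka (T : {ffun cell la -> 'I_K.+1}) : {ffun cell ka -> 'I_K.+1} :=
  [ffun c : cell ka => at_cell ord0 T (cell_row c) (cell_col c)].

Lemma tv_extend k la ka (T : {ffun cell ka -> 'I_K.+1}) i j : (k <= K)%N ->
  (j < nth 0 la i)%N ->
  tv (extend k la T) i j = if (j < nth 0 ka i)%N then tv T i j else k.
Proof.
move=> kK jl; have [c [<- <-]] := cellP jl; rewrite tvE ffunE.
by case: ifP => // _; rewrite inordK.
Qed.

Lemma tv_restrict la ka (T : {ffun cell la -> 'I_K.+1}) i j :
  (j < nth 0 ka i)%N -> tv (restrict ka T) i j = tv T i j.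
Proof. by move=> jl; have [c [<- <-]] := cellP jl; rewrite tvE ffunE. Qed.

Lemma ffun_cellP la (T T' : {ffun cell la -> 'I_K.+1}) :
  (forall i j, (j < nth 0 la i)%N -> tv T i j = tv T' i j) -> T = T'.
Proof.
move=> TT'; apply/ffunP => c; apply: val_inj.
by rewrite /= -!tvE TT' ?cell_lt.
Qed.

Section Interlacing.
Variables (k l : nat) (la ka : seq nat).
Hypotheses (kK : (k <= K)%N) (lla : path geq l la) (sla : size la = k).
Hypothesis kaP : ka \in inter (l :: la).

Lemma inter_nth i : (nth 0 (l :: la) i.+1 <= nth 0 ka i <= nth 0 (l :: la) i)%N.
Proof.
case/interP: kaP => ska H; case: (ltnP i (size la)) => ik; first exact: H.
by rewrite (nth_default _ (s := ka)) ?ska //= nth_default.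
Qed.

Lemma extend_restrict (T : {ffun cell (l :: la) -> 'I_K.+1}) :
  ssyt k.+1 T -> bounded_by k ka T -> extend k (l :: la) (restrict ka T) = T.
Proof.
move=> /ssytP[_ _ Tk] /bounded_byP B; apply: ffun_cellP => i j jl.
rewrite tv_extend //; case: ifP => jk; first by rewrite tv_restrict.
apply/eqP; rewrite eqn_leq leqNgt B // jk /=.
by rewrite -ltnS Tk.
Qed.

Lemma restrict_extend (T : {ffun cell ka -> 'I_K.+1}) :
  restrict ka (extend k (l :: la) T) = T.
Proof.
apply: ffun_cellP => i j jk; rewrite tv_restrict // tv_extend ?jk //.
by case/andP: (inter_nth i) => _; apply: leq_trans.
Qed.

Lemma ssyt_extend (T : {ffun cell ka -> 'I_K.+1}) :
  ssyt k.+1 (extend k (l :: la) T) && bounded_by k ka (extend k (l :: la) T) = ssyt k T.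
Proof.
have la_sorted : sorted geq (l :: la) by [].
have [ka_sorted _] := inter_sorted lla kaP.
have kl i j : (j < nth 0 ka i)%N -> (j < nth 0 (l :: la) i)%N.
  by case/andP: (inter_nth i) => _ le /leq_trans; apply.
apply/andP/idP => [[/ssytP[row col _] /bounded_byP B]|/ssytP[row col Tk]].
  apply/ssytP; split.
  - move=> i j j' jj' j'k; have := row i j j' jj' (kl _ _ j'k).
    by rewrite !tv_extend ?kl ?j'k ?(ltn_trans jj' j'k).
  - move=> i i' j ii' jk jk'; have := col i i' j ii' (kl _ _ jk) (kl _ _ jk').
    by rewrite !tv_extend ?kl ?jk ?jk'.
  - move=> i j jk; have := B i j (kl _ _ jk).
    by rewrite tv_extend ?kl ?jk.
split; last first.
  apply/bounded_byP => i j jl; rewrite tv_extend //.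
  by case: ifP => jk; [rewrite Tk|rewrite ltnn].
apply/ssytP; split.
- move=> i j j' jj' j'l; rewrite !tv_extend ?(ltn_trans jj' j'l) //.
  case: ifP => jk; case: ifP => j'k //; first exact: row.
    exact/ltnW/Tk.
  by rewrite (ltn_trans jj' j'k) in jk.
- move=> i i' j ii' jl jl'; rewrite !tv_extend //.
  have -> : (j < nth 0 ka i)%N.
    apply: leq_trans jl' _; case/andP: (inter_nth i) => + _; apply: leq_trans.
    exact: sorted_nth.
  have jk : (j < nth 0 ka i)%N.
    apply: leq_trans jl' _; case/andP: (inter_nth i) => + _; apply: leq_trans.
    exact: sorted_nth.
  by case: ifP => jk'; [apply: col|apply: Tk].
- move=> i j jl; rewrite tv_extend //; case: ifP => // jk.
  exact/leqW/Tk.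
Qed.

Lemma prod_extend (T : {ffun cell ka -> 'I_K.+1}) :
  \prod_(c : cell (l :: la)) x (extend k (l :: la) T c) =
  x k ^+ (sumn (l :: la) - sumn ka) * \prod_(c : cell ka) x (T c).
Proof.
under eq_bigr do rewrite -tvE; under [in RHS]eq_bigr do rewrite -tvE.
rewrite (big_cell _ _ (fun i j => x (tv (extend k (l :: la) T) i j))).
rewrite (big_cell _ _ (fun i j => x (tv T i j))).
have -> : (sumn (l :: la) - sumn ka =
    \sum_(i < (size la).+1) (nth 0 (l :: la) i - nth 0 ka i))%N.
  have /interP[ska _] := kaP; rewrite sumnB => [|i _]; last by case/andP: (inter_nth i).
  rewrite !sumn_nth /= ska; congr (_ - _)%N.
  by rewrite big_ord_recr /= (nth_default _ (s := ka)) ?ska // addn0.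
have -> : \prod_(i < size ka) \prod_(j < nth 0%N ka i) x (tv T i j) =
    \prod_(i < (size la).+1) \prod_(j < nth 0%N ka i) x (tv T i j).
  have /interP[-> _] := kaP; rewrite [RHS]big_ord_recr /= nth_default ?big_ord0 ?mulr1 //.
  by have /interP[-> _] := kaP.
rewrite -prodrXr -big_split; apply: eq_bigr => i _ /=.
have /andP[_ le] := inter_nth i.
rewrite -!(big_mkord xpredT (fun j => x (tv _ i j))) (big_cat_nat _ (n := nth 0%N ka i)) //= mulrC.
congr (_ * _).
  rewrite -[RHS]prodr_const_nat; apply: eq_big_nat => j /andP[kj jl].
  by rewrite tv_extend // ltnNge kj.
apply: eq_big_nat => j /andP[_ jk].
by rewrite tv_extend ?jk // (leq_trans jk).
Qed.

End Interlacing.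

(** Removing the cells with the largest entry k leaves a tableau of an interlacing shape; the
    removed cells give the power of x_k. *)
Lemma ssyt_sum_gt k la : (k <= K.+1)%N -> size la = k -> sorted geq la ->
  ssyt_sum k la = gt x k la.
Proof.
elim: k la => [|k IH] la kK.
  move/size0nil=> -> _ /=.
  have no_cell (c : cell [::]) : False by case: c => -[].
  rewrite /ssyt_sum (big_pred1 [ffun=> ord0]) => [|T].
    by rewrite big1 // => c; case: (no_cell c).
  rewrite /= (_ : T = [ffun=> ord0]) ?eqxx; last by apply/ffunP => c; case: (no_cell c).
  by apply/andP; split; apply/forallP => c; case: (no_cell c).
case: la => // l la [sla] lla.
have -> : gt x k.+1 (l :: la) = inter_sum (x k) (l :: la) (gt x k) by [].
rewrite inter_sumE.
transitivity (\sum_(T : {ffun cell (l :: la) -> 'I_K.+1} | ssyt k.+1 T)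
  \sum_(ka <- inter (l :: la)) (if bounded_by k ka T then \prod_c x (T c) else 0)).
  by apply: eq_bigr => T TP; apply: bounded_by_unique.
rewrite exchange_big; apply: eq_big_seq => ka kaP.
rewrite -big_mkcondr (reindex_onto (@extend k (l :: la) ka)
  (@restrict (l :: la) ka)) /=; last first.
  by move=> T /andP[TP TB]; apply: extend_restrict TP TB.
have [ka_sorted ska] := inter_sorted lla kaP.
rewrite -IH ?ska // 1?ltnW // mulr_sumr; apply: eq_big => [T|T _].
  by rewrite restrict_extend // eqxx andbT ssyt_extend.
exact: prod_extend.
Qed.
End Branching.

(** * Schur polynomials *)

Definition mvar k (i : nat) : {mpoly int[k]} :=
  if insub i is Some j then 'X_j else 0.

Lemma mvarE k (i : 'I_k) : mvar k i = 'X_i.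
Proof. by rewrite /mvar valK. Qed.

Lemma schurE k la : size la = k -> sorted geq la -> schur k la = gt (mvar k) k la.
Proof.
(* Tableaux above have entries in a nonempty ordinal, so the case of no variables is separate. *)
case: k => [|k] sla la_sorted.
  move: la_sorted; rewrite (size0nil sla) => _ /=.
  have no_cell (c : cell [::]) : False by case: c => -[].
  have c0 : #|{: cell [::]}| = 0%N by apply: eq_card0 => c; case: (no_cell c).
  rewrite /schur (big_pred1 (ffun0 (rT := fun=> 'I_0) c0)) => [|T].
    by rewrite big1 // => c; case: (no_cell c).
  rewrite /= (_ : T = ffun0 _) ?eqxx; last by apply/ffunP => c; case: (no_cell c).
  by apply/forallP => c; case: (no_cell c).
rewrite -(@ssyt_sum_gt k _ (mvar k.+1) _ la) //; apply: eq_big => [T|T _].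
  by rewrite /ssyt (introT forallP) ?andbT.
by apply: eq_bigr => c _; rewrite mvarE.
Qed.

(** * Linear independence of the Schur polynomials *)

Lemma nth_leq_eq (p q : seq nat) : size p = size q ->
  (forall i, nth 0 p i <= nth 0 q i)%N -> (sumn q <= sumn p)%N -> p = q.
Proof.
elim: p q => [|a p IH] [|b q] //= [pq] le s.
have ab := le 0%N; have le' i := le i.+1; rewrite /= in ab le'.
have pq' : (sumn p <= sumn q)%N.
  by rewrite !sumn_nth pq; apply: leq_sum => i _; apply: le'.
by congr (_ :: _); [lia|apply: IH => //; lia].
Qed.

Section Kronecker.
Variable B : nat.

(* Substituting X^(B^i) for x_i turns monomials with exponents less than B into
   powers of X, according to their base B expansions. *)
Definition weight (la : seq nat) : nat := (\sum_(i < size la) nth 0 la i * B ^ i)%N.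

Definition kron (i : nat) : {poly int} := 'X^(B ^ i).

Lemma weight_rcons la a : weight (rcons la a) = (weight la + a * B ^ size la)%N.
Proof.
rewrite /weight size_rcons big_ord_recr /= nth_rcons ltnn eqxx; congr (_ + _)%N.
by apply: eq_bigr => i _; rewrite nth_rcons ltn_ord.
Qed.

Lemma weight_lt la : all (fun a => a < B)%N la -> (weight la < B ^ size la)%N.
Proof.
elim/last_ind: la => [|la a IH]; first by rewrite /weight big_ord0.
rewrite all_rcons => /andP[aB /IH lt]; rewrite weight_rcons size_rcons expnS.
apply: (@leq_trans (B ^ size la + a * B ^ size la)); first by rewrite ltn_add2r.
by rewrite -mulSn leq_mul2r aB orbT.
Qed.

Lemma weight_inj la mu : all (fun a => a < B)%N la -> all (fun a => a < B)%N mu ->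
  size la = size mu -> weight la = weight mu -> la = mu.
Proof.
elim/last_ind: la mu => [|la a IH] mu; first by move=> _ _ /esym/size0nil.
case/lastP: mu => [|mu b]; first by rewrite size_rcons.
rewrite !all_rcons !size_rcons => /andP[aB laB] /andP[bB muB] [s].
rewrite !weight_rcons s => e.
have la_lt := weight_lt laB; have mu_lt := weight_lt muB; rewrite s in la_lt.
have B0 : (0 < B ^ size mu)%N by apply: leq_ltn_trans la_lt.
have ab : a = b.
  have := congr1 (divn^~ (B ^ size mu)%N) e.
  by rewrite /= !divnDMl // !divn_small.
by move: e; rewrite ab => /addIn /IH ->.
Qed.

(** As B^i grows with i, the cheapest monomial puts the largest parts on the first variables: it is
    x^la, which has coefficient 1. *)
Lemma coef_gt_kron k la j : size la = k -> sorted geq la ->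
  all (fun a => a < B)%N la -> (j <= weight la)%N ->
  (gt kron k la)`_j = (j == weight la)%:R.
Proof.
elim: k la j => [|k IH] la j.
  by move/size0nil-> => _ _; rewrite /weight big_ord0 leqn0 coef1 => /eqP->.
case/lastP: la => [|la a]; first by [].
rewrite size_rcons => -[sla]; rewrite weight_rcons all_rcons sla => la_sorted /andP[aB laB] jw.
have [l [t lE]] : exists l t, rcons la a = l :: t.
  by case: (la) => [|l t]; [exists a, [::]|exists l, (rcons t a)].
have lt : path geq l t by move: la_sorted; rewrite lE.
have st : size t = k by move: (congr1 size lE); rewrite size_rcons sla => -[].
have la_in : la \in inter (rcons la a).
  rewrite lE; apply/interP; rewrite st sla; split=> // i ik.
  have -> : nth 0 la i = nth 0 (l :: t) i by rewrite -lE nth_rcons sla ik.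
  rewrite leqnn andbT -[nth _ t i]/(nth 0 (l :: t) i.+1).
  exact: sorted_nth.
have -> : gt kron k.+1 (rcons la a) = inter_sum (kron k) (rcons la a) (gt kron k) by [].
(* The q of largest size is the partition without its last part; it gives x_k the smallest exponent.
   Any other q raises this exponent, which costs at least B^k, more than [weight la]. *)
rewrite inter_sumE (bigD1_seq la) ?uniq_inter //= coefD coef_sum big1_seq; last first.
  move=> q /andP[qla qP]; rewrite /kron -exprM coefXnM ifT //.
  apply: leq_ltn_trans jw _.
  have lt1 : (sumn q < sumn la)%N.
    move: qP; rewrite lE => /interP[sq qle]; rewrite st in sq qle.
    rewrite ltnNge; apply: contra qla => le; apply/eqP; apply: nth_leq_eq le.
      by rewrite sq sla.
    move=> i; case: (ltnP i k) => ik; last by rewrite nth_default ?sq.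
    by case/andP: (qle i ik); rewrite -lE nth_rcons sla ik.
  apply: (@leq_trans (B ^ k * a.+1)).
    by rewrite mulnSr addnC mulnC ltn_add2l -sla weight_lt.
  rewrite leq_mul2l -cats1 sumn_cat /=; apply/orP; right; lia.
rewrite addr0 /kron -exprM coefXnM -cats1 sumn_cat /= addKn addn0.
case: ltnP => jk; first by rewrite ltn_eqF // (leq_trans jk) // mulnC leq_addl.
rewrite mulnC in jk *; rewrite IH ?sla //.
- by rewrite -(eqn_add2r (a * B ^ k)) subnK.
- by apply: subseq_sorted la_sorted; rewrite ?subseq_rcons //; move=> ? ? ? ? /leq_trans; apply.
- by rewrite leq_subLR addnC.
Qed.
End Kronecker.

Lemma sumn_all (s : seq nat) : all (fun a => a <= sumn s)%N s.
Proof.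
elim: s => //= a s IH; rewrite leq_addr /=.
by apply: sub_all IH => b /leq_trans; apply; apply: leq_addl.
Qed.

Lemma partition_tuple k N nu : partition_of k N nu ->
  exists t : k.-tuple 'I_N.+1, map val t = nu.
Proof.
case/and3P=> /eqP snu _ /eqP <-.
have st : size (map (inord : nat -> 'I_(sumn nu).+1) nu) == k by rewrite size_map snu.
exists (Tuple st); rewrite /= -map_comp -[RHS]map_id; apply/eq_in_map => a a_nu.
by rewrite /= inordK // ltnS (allP (sumn_all nu)).
Qed.

Lemma eq_gt (R : comNzRingType) (x y : nat -> R) k la : size la = k ->
  (forall i, (i < k)%N -> x i = y i) -> gt x k la = gt y k la.
Proof.
elim: k la => // k IH [|l la] // [sla] xy; rewrite /= -/(inter_sum _ (l :: la) _).
rewrite -/(inter_sum _ (l :: la) (gt y k)) xy //; apply: eq_inter_sum_size => q sq.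
by apply: IH => [|i ik]; [rewrite sq|apply/xy/leqW].
Qed.

(** In the coefficient of degree [weight nu], lighter terms vanish by induction, heavier ones have
    not started, and equal weight means equal partitions. *)
Lemma schur_free k N (c : seq nat -> int) :
  \sum_(nu : k.-tuple 'I_N.+1 | partition_of k N (map val nu))
    c (map val nu) *: schur k (map val nu) = 0 ->
  forall nu, partition_of k N nu -> c nu = 0.
Proof.
move=> c_sum nu; have [n] := ubnP (weight N.+1 nu).
elim: n nu => // n IH nu /ltnSE nun nuP.
pose f : {rmorphism {mpoly int[k]} -> {poly int}} :=
  mmap (intr : int -> {poly int}) (fun i : 'I_k => kron N.+1 i).
have fE la : partition_of k N la -> f (schur k la) = gt (kron N.+1) k la.
  case/and3P=> /eqP sla la_sorted _; rewrite schurE // gt_map //.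
  apply: eq_gt => // i ik; rewrite /comp -[i]/(val (Ordinal ik)) mvarE.
  by rewrite /f /= mmapX mmap1U.
have bounded la : partition_of k N la -> all (fun a => a < N.+1)%N la.
  by case/and3P=> _ _ /eqP <-; apply: sub_all (sumn_all la).
have := congr1 (fun p => (f p)`_(weight N.+1 nu)) c_sum.
rewrite /= rmorph0 coef0 rmorph_sum coef_sum.
have [t tE] := partition_tuple nuP.
have coef_term la : partition_of k N la -> (weight N.+1 nu <= weight N.+1 la)%N ->
    (f (c la *: schur k la))`_(weight N.+1 nu) =
    if weight N.+1 nu == weight N.+1 la then c la else 0.
  move=> laP le; rewrite [f _]mmapZ (fE _ laP) mulrzl coefMrz.
  have /and3P[/eqP sla la_sorted _] := laP.
  rewrite coef_gt_kron ?(bounded _ laP) //.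
  by case: eqP => _; rewrite ?mul0rz // intz.
rewrite (bigD1 t) ?tE //= big1 ?addr0 => [|u /andP[uP ut]].
  by rewrite coef_term // eqxx.
case: (ltnP (weight N.+1 (map val u)) (weight N.+1 nu)) => [lt|le].
  by rewrite (IH _ (leq_trans lt nun) uP) scale0r rmorph0 coef0.
rewrite coef_term //; case: eqP => // e; case/eqP: ut.
apply: val_inj; apply: (inj_map val_inj); rewrite /= tE.
apply: (weight_inj (bounded _ uP) (bounded _ nuP)) => //.
have /and3P[/eqP -> _ _] := nuP; exact: (eqP (let: And3 a _ _ := and3P uP in a)).
Qed.

(** * Littlewood-Richardson coefficients as puzzle counts *)

Lemma sum_tri_partitions (V : zmodType) k m N p u (F : seq nat -> V) :
  path geq m p -> path geq m u -> size p = k -> size u = k ->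
  (sumn p + sumn u)%N = N ->
  \sum_(nu <- tri (lab (str m p)) (lab (str m u))) F (unlab nu) =
  \sum_(t : k.-tuple 'I_N.+1 | partition_of k N (map val t))
    F (map val t) *+ puz m p u (map val t).
Proof.
move=> mp mu sp su pu.
transitivity (\sum_(nu <- tri (lab (str m p)) (lab (str m u)))
  \sum_(t : k.-tuple 'I_N.+1 | partition_of k N (map val t))
    F (map val t) *+ (nu == lab (str m (map val t)))).
  apply: eq_big_seq => nu nuP; have pu' : size p = size u by rewrite sp su.
  have [nuE mnu snu] := tri_str mp mu pu' nuP.
  have nuN : partition_of k N (unlab nu).
    rewrite /partition_of snu sp (tri_sumn mp mu pu' nuP) pu !eqxx andbT.
    exact: path_sorted mnu.
  have [t tE] := partition_tuple nuN.
  rewrite (bigD1 t) ?tE //= -nuE eqxx big1 ?addr0 // => v /andP[vN vt].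
  case: eqP => // e; case/eqP: vt; apply: val_inj; apply: (inj_map val_inj).
  rewrite /= tE e unlab_lab parts_str_sorted //.
  by case/and3P: vN.
rewrite exchange_big; apply: eq_bigr => t _.
rewrite sumrMnr; congr (_ *+ _); rewrite /puz -sum1_count [RHS]big_mkcond.
by apply: eq_bigr => nu _; rewrite /=; case: (nu == _).
Qed.

Lemma lr_coefE k m p u q : path geq m p -> path geq m u -> path geq m q ->
  size p = k -> size u = k -> size q = k ->
  lr_coef k p u q = (puz m p u q)%:Z.
Proof.
move=> mp mu mq sp su sq.
(* M exceeds the degree N, as [gt_mul] requires; [puzM] leads back to m. *)
pose N := (sumn p + sumn u)%N; pose M := (m + N.+1)%N.
have mM : (m <= M)%N by rewrite leq_addr.
have puzM d : puz (m + d) p u q = puz m p u q.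
  elim: d => [|d IH]; first by rewrite addn0.
  have md r : path geq m r -> path geq (m + d) r by apply: path_geqW; apply: leq_addr.
  by rewrite addnS puz_pad ?IH // md.
pose c nu := if partition_of k N nu then (puz M p u nu)%:Z else 0.
have cP : schur_expansion k p u c.
  split=> [nu nuN|]; first by rewrite /c (negPf nuN).
  rewrite !schurE ?(path_sorted mp) ?(path_sorted mu) //.
  have := @gt_mul _ (mvar k) M p u.
  rewrite su sp => -> //; rewrite ?(path_geqW mM) //; last by rewrite /M /N; lia.
  rewrite (sum_tri_partitions (k := k) (N := N)) ?(path_geqW mM) //.
  apply: eq_bigr => t tN; have /and3P[/eqP st t_sorted _] := tN.
  by rewrite /c tN schurE // -[(_)%:Z]intz scaler_int -pmulrn.
have eP : schur_expansion k p u (epsilon (inhabits (fun _ : seq nat => 0 : int))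
    (schur_expansion k p u)) by apply: epsilon_spec; exists c.
(* The family chosen by [epsilon] and [c] both expand the product: they agree on partitions of N by
   independence, and are 0 elsewhere. *)
have -> : lr_coef k p u q = c q.
  case qN: (partition_of k N q); last by rewrite /c qN /lr_coef eP.1 ?qN.
  apply/eqP; rewrite -subr_eq0; apply/eqP.
  apply: (@schur_free _ _ (fun nu => lr_coef k p u nu - c nu) _ q qN).
  under eq_bigr do rewrite scalerBl.
  by rewrite sumrB -cP.2 -eP.2 subrr.
rewrite /c; case: ifP => qN; first by rewrite /M puzM.
congr Posz; apply/esym/count_memPn; apply/negP => qP.
have := tri_sumn mp mu (etrans sp (esym su)) qP.
rewrite unlab_lab parts_str // => qs; move: qN.
by rewrite /partition_of sq qs !eqxx (path_sorted mq).
Qed.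

Lemma lrE n k (la mu nu : bstr n k) :
  lr la mu nu = (count_mem (lab (val nu)) (tri (lab (val la)) (lab (val mu))))%:Z.
Proof.
have sE (s : bstr n k) : [/\ path geq (n - k)%N (parts (val s)), size (parts (val s)) = k &
    str (n - k)%N (parts (val s)) = val s].
  have cs : (count id (val s : seq bool) = k)%N by apply/eqP; case: s.
  have ss : (count negb (val s : seq bool) = n - k)%N.
    have := count_predC id (val s : seq bool); rewrite cs size_tuple => e.
    exact: (canRL (addKn k)).
  by rewrite path_parts ?ss // size_parts cs -ss str_parts.
have [mla sla laE] := sE la; have [mmu smu muE] := sE mu; have [mnu snu nuE] := sE nu.
by rewrite /lr !bstr_partE (@lr_coefE _ (n - k)%N) // /puz laE muE nuE.
Qed.

(** * Sums over labelings *)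

(** Summing over total functions one edge at a time allows edges to be reordered and factors to be
    pulled out, independently of any fixed finite set of edges. *)
Section Labelings.
Variable E : eqType.
Implicit Types (f g : E -> label) (F G : (E -> label) -> int) (es : seq E).

Definition upd f e l : E -> label := fun e' => if e' == e then l else f e'.

(* The sum of F over all labelings that coincide with f outside es. *)
Fixpoint lsum es F f : int :=
  if es is e :: es' then (\sum_l lsum es' F (upd f e l)) else F f.

Lemma lsum_cons e es F f : lsum (e :: es) F f = (\sum_l lsum es F (upd f e l)).
Proof. by []. Qed.

Lemma eq_lsum es F G f :
  (forall g, (forall e, e \notin es -> g e = f e) -> F g = G g) ->
  lsum es F f = lsum es G f.
Proof.
elim: es f => [|e es IH] f FG /=; first exact: FG.
apply: eq_bigr => l _; apply: IH => g gf; apply: FG => e'.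
by rewrite inE negb_or => /andP[e'e /gf ->]; rewrite /upd (negPf e'e).
Qed.

Lemma lsum_cat es es' F f : lsum (es ++ es') F f = lsum es (lsum es' F) f.
Proof. by elim: es f => //= e es IH f; apply: eq_bigr => l _. Qed.

Lemma updC f e l e' l' : e != e' -> upd (upd f e l) e' l' = upd (upd f e' l') e l.
Proof.
move=> ee'; apply: functional_extensionality => d; rewrite /upd.
by case: eqP => // ->; rewrite eq_sym (negPf ee').
Qed.

Lemma lsum_perm es es' F f : uniq es -> perm_eq es es' -> lsum es F f = lsum es' F f.
Proof.
elim: es es' f => [|e es IH] es' f.
  by move=> _; rewrite perm_sym => /perm_nilP->.
case/andP=> e_es es_uniq /[dup] ees'.
have : e \in es' by rewrite -(perm_mem ees') mem_head.
case/splitPr=> s1 s2; rewrite perm_sym perm_catC /= perm_cons => es_perm.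
have {}es_perm : perm_eq es (s1 ++ s2) by rewrite perm_sym perm_catC.
rewrite lsum_cat /=.
transitivity (lsum s1 (fun g => (\sum_l lsum s2 F (upd g e l))) f) => //.
have e_s1 : e \notin s1.
  by apply: contra e_es; rewrite (perm_mem es_perm) mem_cat => ->.
transitivity (\sum_l lsum (s1 ++ s2) F (upd f e l)).
  by apply: eq_bigr => l _; apply: IH.
under eq_bigr do rewrite lsum_cat.
elim: s1 f e_s1 {es_perm ees'} => //= d s1 IHs f; rewrite inE negb_or => /andP[ed e_s1].
rewrite exchange_big; apply: eq_bigr => l _; rewrite -IHs //.
by apply: eq_bigr => l' _; rewrite updC // eq_sym.
Qed.

Lemma lsum_mull es F G f :
  (forall g, (forall e, e \notin es -> g e = f e) -> G g = G f) ->
  lsum es (fun g => (G g * F g)) f = (G f * lsum es F f).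
Proof.
move=> GP; rewrite (@eq_lsum _ _ (fun g => (G f * F g))) => [|g /GP-> //].
move: (G f) => c; elim: es f {GP} => //= e es IH f.
by rewrite mulr_sumr; apply: eq_bigr.
Qed.

Fixpoint words n : seq (seq label) :=
  if n is n'.+1 then gather (fun l => [seq l :: w | w <- words n']) else [:: [::]].

Lemma sum_words n (K : seq label -> int) :
  (\sum_(w <- words n.+1) K w = \sum_l \sum_(w <- words n) K (l :: w)).
Proof. by rewrite big_gather; apply: eq_bigr => l _; rewrite big_map. Qed.

Lemma uniq_words n : uniq (words n).
Proof.
elim: n => //= n IH; rewrite /gather !cat_uniq !map_inj_uniq ?IH; try by move=> ? ? [].
rewrite andbT !has_cat !negb_or /=.
by do ?[apply/andP; split => //]; apply/hasPn => _ /mapP[w _ ->]; apply/mapP => -[].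
Qed.

Lemma mem_words n w : (w \in words n) = (size w == n).
Proof.
elim: n w => [|n IH] w; first by rewrite inE; case: w.
apply/gatherP/idP => [[l /mapP[v]]|].
  by rewrite IH => /eqP <- ->.
by case: w => //= l w; rewrite eqSS -IH => wP; exists l; apply: map_f.
Qed.

Lemma lsum_words es (K : seq label -> int) f : uniq es ->
  lsum es (fun g => K (map g es)) f = (\sum_(w <- words (size es)) K w).
Proof.
elim: es K f => [|e es IH] K f; first by rewrite big_seq1.
case/andP=> e_es es_uniq; rewrite lsum_cons [size _]/= sum_words; apply: eq_bigr => l _.
rewrite (@eq_lsum _ _ (fun g => K (l :: map g es))) ?(IH (fun w => K (l :: w))) //.
by move=> g /(_ e e_es) /= ->; rewrite /upd eqxx.
Qed.

Fixpoint wordss (ns : seq nat) : seq (seq (seq label)) :=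
  if ns is n :: ns' then flatten [seq [seq w :: ws | ws <- wordss ns'] | w <- words n]
  else [:: [::]].

Lemma sum_wordss n ns (K : seq (seq label) -> int) :
  (\sum_(ws <- wordss (n :: ns)) K ws =
   \sum_(w <- words n) \sum_(ws <- wordss ns) K (w :: ws)).
Proof. by rewrite /= big_flatten big_map; apply: eq_bigr => w _; rewrite big_map. Qed.

Lemma uniq_wordss ns : uniq (wordss ns).
Proof.
elim: ns => //= n ns IH; apply: allpairs_uniq; rewrite ?uniq_words //.
by move=> [w ws] [v vs] _ _ [-> ->].
Qed.

Lemma mem_wordss ns ws : (ws \in wordss ns) = (map size ws == ns).
Proof.
elim: ns ws => [|n ns IH] ws; first by rewrite inE; case: ws.
apply/allpairsP/idP => [[[w vs] /= []]|].
  by rewrite mem_words IH => /eqP <- /eqP <- ->.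
case: ws => //= w ws; rewrite eqseq_cons -mem_words -IH => /andP[wP wsP].
by exists (w, ws).
Qed.

Lemma lsum_wordss (ess : seq (seq E)) (K : seq (seq label) -> int) f :
  uniq (flatten ess) ->
  lsum (flatten ess) (fun g => K (map (map g) ess)) f =
  (\sum_(ws <- wordss (map size ess)) K ws).
Proof.
elim: ess K f => [|es ess IH] K f; first by rewrite big_seq1.
rewrite [flatten _]/= [map size _]/= cat_uniq => /and3P[es_uniq disj ess_uniq].
rewrite lsum_cat sum_wordss -(lsum_words (fun w => \sum_(ws <- _) K (w :: ws)) f es_uniq).
apply: eq_lsum => g _; rewrite -(IH (fun ws => K (map g es :: ws)) g) //.
apply: eq_lsum => h hP; congr K; rewrite /=; congr (_ :: _); apply/eq_in_map => e e_es.
by apply: hP; apply: contra disj => e_ess; apply/hasP; exists e.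
Qed.
End Labelings.

Lemma lsum_map (E E' : eqType) (phi : E -> E') es (F : (E -> label) -> int) f :
  injective phi ->
  lsum (map phi es) (fun g => F (g \o phi)) f = lsum es F (f \o phi).
Proof.
move=> phi_inj; elim: es f => //= e es IH f; apply: eq_bigr => l _.
rewrite IH; congr lsum; apply: functional_extensionality => e'.
by rewrite /upd /= (inj_eq phi_inj).
Qed.

(** * Labelings of the triangle with vertices (0, 0), (n, 0), (0, n) *)

Implicit Types (f g h : edge -> label).

Definition up_ok g x y := piece (g (D60, x, y)) (g (D120, x, y)) (g (D0, x, y)).
Definition down_ok g x y :=
  piece (g (D0, x, y.+1)) (g (D60, x.+1, y)) (g (D120, x, y)).

Definition tri_ok n g : bool :=
  [forall x : 'I_n, forall y : 'I_n,
    ((x + y < n) ==> up_ok g x y) && ((x + y.+1 < n) ==> down_ok g x y)]%N.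

Lemma tri_okP n g : reflect
  ((forall x y, (x + y < n)%N -> up_ok g x y) /\
   (forall x y, (x + y.+1 < n)%N -> down_ok g x y)) (tri_ok n g).
Proof.
apply: (iffP forallP) => [H|[up down] x].
  have lt x y : (x + y < n)%N -> (x < n)%N /\ (y < n)%N by lia.
  split=> x y xy.
    have [xn yn] := lt _ _ xy.
    by have /forallP/(_ (Ordinal yn))/andP[/implyP imp _] := H (Ordinal xn); apply: imp.
  have [xn yn] : (x < n)%N /\ (y < n)%N by lia.
  by have /forallP/(_ (Ordinal yn))/andP[_ /implyP imp] := H (Ordinal xn); apply: imp.
by apply/forallP => y; rewrite !(introT implyP) //; [apply: down|apply: up].
Qed.

Fixpoint strip_ok i k g : bool :=
  if k is k'.+1 then [&& up_ok g 0 i, down_ok g 0 i & strip_ok i.+1 k' g]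
  else up_ok g 0 i.

Lemma strip_okP i k g : reflect
  ((forall y, (i <= y <= i + k)%N -> up_ok g 0 y) /\
   (forall y, (i <= y < i + k)%N -> down_ok g 0 y)) (strip_ok i k g).
Proof.
elim: k i => [|k IH] i /=.
  rewrite addn0; apply: (iffP idP) => [up|[up _]]; last by apply: up; rewrite leqnn.
  by split=> y; [rewrite -eqn_leq => /eqP<-|case: ltngtP].
apply: (iffP and3P) => [[up down /IH[ups downs]]|[up down]].
  split=> y; rewrite addnS -addSn.
    by case: (ltngtP i y) => // [iy yk|<- _] //; apply: ups; rewrite iy.
  by case: (ltngtP i y) => // [iy yk|<- _] //; apply: downs; rewrite iy.
split; [apply: up|apply: down|apply/IH; split=> y yP; [apply: up|apply: down]]; lia.
Qed.

Definition shift (e : edge) : edge := let: (d, x, y) := e in (d, x.+1, y).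

Lemma shift_inj : injective shift.
Proof. by move=> [[d x] y] [[d' x'] y'] [-> -> ->]. Qed.

Lemma tri_okS n g : tri_ok n.+1 g = strip_ok 0 n g && tri_ok n (g \o shift).
Proof.
apply/tri_okP/andP => [[up down]|[/strip_okP[up0 down0] /tri_okP[up down]]].
  split; first by apply/strip_okP; split=> y yP; [apply: up|apply: down]; lia.
  by apply/tri_okP; split=> x y xy; [apply: (up x.+1)|apply: (down x.+1)]; lia.
split=> -[|x] y xy; [apply: up0|apply: up|apply: down0|apply: down]; lia.
Qed.

(** The order is that in which [strip] chooses z, y and m, so that both sums unfold alike. *)
Fixpoint strip_edges i k : seq edge :=
  if k is k'.+1 then
    [:: (D120, 0%N, i), (D0, 0%N, i.+1), (D60, 1%N, i) & strip_edges i.+1 k']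
  else [::].

Lemma strip_edgesS i k : strip_edges i k.+1 =
  [:: (D120, 0%N, i), (D0, 0%N, i.+1), (D60, 1%N, i) & strip_edges i.+1 k].
Proof. by []. Qed.

Fixpoint interior n : seq edge :=
  if n is n'.+1 then strip_edges 0 n' ++ map shift (interior n') else [::].

Lemma mem_strip_edges i k d x y : ((d, x, y) \in strip_edges i k) =
  match d with
  | D120 => (x == 0) && (i <= y < i + k)
  | D0 => (x == 0) && (i < y <= i + k)
  | D60 => (x == 1) && (i <= y < i + k)
  end%N.
Proof.
elim: k i => [|k IH] i.
  by rewrite in_nil addn0; case: d; case: (x == _) => //=; lia.
have E d' x' y' : ((d, x, y) == (d', x', y') :> edge) = [&& d == d', x == x' & y == y'].
  by rewrite !xpair_eqE andbA.
rewrite !inE !E IH; case: d {IH E}; rewrite /=; lia.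
Qed.

Lemma mem_map_shift es d x y : ((d, x, y) \in map shift es) =
  (0 < x)%N && ((d, x.-1, y) \in es).
Proof.
apply/mapP/idP => [[[[d' x'] y'] + [-> -> ->]] //|/andP[x0 H]].
by exists (d, x.-1, y) => //=; rewrite prednK.
Qed.

Lemma mem_interior n d x y : ((d, x, y) \in interior n) =
  match d with
  | D120 => (x + y.+1 < n)
  | D0 => (0 < y) && (x + y < n)
  | D60 => (0 < x) && (x + y < n)
  end%N.
Proof.
elim: n d x y => [|n IH] d x y; first by case: d; rewrite /= ?ltn0 ?andbF.
rewrite mem_cat mem_strip_edges.
by rewrite mem_map_shift IH; case: d; case: x => [|x] /=; lia.
Qed.

Lemma uniq_strip_edges i k : uniq (strip_edges i k).
Proof.
elim: k i => //= k IH i; rewrite !inE !mem_strip_edges IH !ltnn !andbF /=.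
by [].
Qed.

Lemma uniq_interior n : uniq (interior n).
Proof.
elim: n => //= n IH; rewrite cat_uniq uniq_strip_edges (map_inj_uniq shift_inj) IH andbT.
apply/hasPn => _ /mapP[[[d x] y] + ->]; rewrite /= mem_strip_edges mem_interior.
by case: d => /=; lia.
Qed.

Definition nw_side n : seq edge := [seq (D60, 0%N, i) | i <- iota 0 n].
Definition ne_side n : seq edge := [seq (D120, i, (n - i.+1)%N) | i <- iota 0 n].
Definition s_side n : seq edge := [seq (D0, i, 0%N) | i <- iota 0 n].

Lemma lsum_strip i k (K : seq label -> int) g :
  lsum (strip_edges i k)
    (fun h => (strip_ok i k h)%:R * K [seq h (D60, 1%N, j) | j <- iota i k]) g =
  \sum_(r <- strip [seq g (D60, 0%N, j) | j <- iota i k.+1] (g (D0, 0%N, i))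
                   (g (D120, 0%N, (i + k)%N))) K r.
Proof.
elim: k i K g => [|k IH] i K g.
  by rewrite [RHS]sum_strip1 addn0 /= mulr_natl.
have -> : [seq g (D60, 0%N, j) | j <- iota i k.+2] =
    g (D60, 0%N, i) :: [seq g (D60, 0%N, j) | j <- iota i.+1 k.+1] by [].
rewrite sum_strip // strip_edgesS.
rewrite lsum_cons; apply: eq_bigr => z _.
rewrite lsum_cons; apply: eq_bigr => y _.
rewrite lsum_cons; apply: eq_bigr => m _.
set g' := upd _ _ _.
have gE e : e \notin [:: (D120, 0%N, i); (D0, 0%N, i.+1); (D60, 1%N, i)] -> g' e = g e.
  rewrite !inE !negb_or => /and3P[e1 e2 e3].
  by rewrite /g' /upd (negPf e1) (negPf e2) (negPf e3).
have lE : [seq g (D60, 0%N, j) | j <- iota i.+1 k.+1] =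
    [seq g' (D60, 0%N, j) | j <- iota i.+1 k.+1].
  by apply: eq_map => j; rewrite gE.
have g'z : g' (D120, 0%N, i) = z by rewrite /g' /upd /= eqxx.
have g'y : g' (D0, 0%N, i.+1) = y by rewrite /g' /upd /= eqxx.
have g'm : g' (D60, 1%N, i) = m by rewrite /g' /upd eqxx.
rewrite lE -addSnnS -(gE (D120, 0%N, (i.+1 + k)%N)); last first.
  by rewrite !inE !xpair_eqE /=; lia.
rewrite -{1}g'y -(IH i.+1 (fun r => K (m :: r)) g').
rewrite -mulr_natl -(@lsum_mull _ _ _ (fun=> _)) //.
apply: eq_lsum => h hg'.
have hl : h (D60, 0%N, i) = g (D60, 0%N, i).
  by rewrite hg' ?mem_strip_edges // gE.
have hc : h (D0, 0%N, i) = g (D0, 0%N, i).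
  rewrite hg' ?mem_strip_edges ?ltnNge ?leqnSn // gE // !inE !xpair_eqE /= !orbF.
  by rewrite eqn_leq ltnn andbF.
have hz : h (D120, 0%N, i) = z.
  by rewrite hg' ?mem_strip_edges ?ltnn.
have hy : h (D0, 0%N, i.+1) = y.
  by rewrite hg' ?mem_strip_edges ?ltnn.
have hm : h (D60, 1%N, i) = m.
  by rewrite hg' ?mem_strip_edges ?ltnn.
rewrite /= /up_ok /down_ok hl hc hz hy hm.
by rewrite mulrA -natrM !mulnb -andbA.
Qed.

Lemma eq_strip_ok i k g h :
  (forall e, (e.1.2 == 0%N) || (e.1 == (D60, 1%N)) -> g e = h e) ->
  strip_ok i k g = strip_ok i k h.
Proof.
move=> gh; have upE y : up_ok g 0 y = up_ok h 0 y by rewrite /up_ok !gh.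
have downE y : down_ok g 0 y = down_ok h 0 y by rewrite /down_ok !gh.
by elim: k i => [|k IH] i /=; rewrite upE // downE IH.
Qed.

Lemma count_sum (T : Type) (P : pred T) s :
  (count P s)%:R = \sum_(x <- s) (P x)%:R :> int.
Proof. by rewrite -sum1_count natr_sum big_mkcond; apply: eq_bigr => x _; case: (P x). Qed.

Lemma count_tri_cons la b mu c nu :
  (count_mem (c :: nu) (tri la (b :: mu)))%:R =
  \sum_(r <- strip la c b) (count_mem nu (tri r mu))%:R :> int.
Proof.
rewrite count_sum sum_tri (bigD1 c) //= [X in _ + X]big1 ?addr0 => [|c' c'c].
  apply: eq_bigr => r _; rewrite count_sum; apply: eq_bigr => t _.
  by rewrite /= eqseq_cons eqxx.
rewrite big1 // => r _; rewrite big1 // => t _.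
by rewrite /= eqseq_cons (negPf c'c).
Qed.

(** The boundary labels are read off from g. Removing the leftmost strip leaves a smaller triangle,
    moved by [shift]. *)
Lemma lsum_tri n g :
  lsum (interior n) (fun h => (tri_ok n h)%:R) g =
  (count_mem (map g (s_side n)) (tri (map g (nw_side n)) (map g (ne_side n))))%:R.
Proof.
elim: n g => [|n IH] g.
  by rewrite /= (introT (tri_okP _ _)) //; split.
rewrite [interior _]/= lsum_cat.
pose K r : int := (count_mem [seq g (D0, i.+1, 0%N) | i <- iota 0 n]
  (tri r [seq g (D120, i.+1, (n - i.+1)%N) | i <- iota 0 n]))%:R.
transitivity (lsum (strip_edges 0 n)
  (fun h => (strip_ok 0 n h)%:R * K [seq h (D60, 1%N, j) | j <- iota 0 n]) g).
  apply: eq_lsum => h hg.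
  under eq_lsum => h' _ do rewrite tri_okS -mulnb natrM.
  rewrite (@lsum_mull _ _ _ (fun h => (strip_ok 0 n h)%:R)) => [|h' hh']; last first.
    congr (nat_of_bool _)%:R; apply: eq_strip_ok => -[[d x] y] /= xd; apply: hh'.
    by rewrite mem_map_shift mem_interior; case: d xd; case: x => [|[|x]].
  congr (_ * _); rewrite (lsum_map _ (fun h => (tri_ok n h)%:R)); last exact: shift_inj.
  rewrite IH /K; congr (_%:R).
  rewrite -!map_comp; congr (count_mem _ (tri _ _)); apply/eq_in_map => j.
    by move=> _ /=; apply: hg; rewrite mem_strip_edges.
  by move=> _ /=; apply: hg; rewrite mem_strip_edges.
have iotaS : iota 1 n = map succn (iota 0 n) by rewrite (iotaDl 1 0).
rewrite lsum_strip /K add0n [RHS](_ : _ = (count_mem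
  (g (D0, 0%N, 0%N) :: [seq g (D0, i.+1, 0%N) | i <- iota 0 n])
  (tri [seq g (D60, 0%N, j) | j <- iota 0 n.+1]
    (g (D120, 0%N, n) :: [seq g (D120, i.+1, (n - i.+1)%N) | i <- iota 0 n])))%:R).
  by rewrite count_tri_cons.
rewrite /s_side /nw_side /ne_side -!map_comp [iota 0 n.+1]/= /= iotaS -!map_comp.
by rewrite subn1.
Qed.

(** * The hexagon *)

Definition env_of (es : seq edge) (f : {ffun seq_sub es -> label}) : edge -> label :=
  fun e => odflt L0 (omap f (insub e)).

Lemma sum_ffun_lsum (es : seq edge) (F : (edge -> label) -> int) : uniq es ->
  \sum_(f : {ffun seq_sub es -> label}) F (env_of f) = lsum es F (fun=> L0).
Proof.
move=> es_uniq.
(* Generalized to labelings frozen to g off ts, so that edges are released one by one. *)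
have H (ts : seq (seq_sub es)) (g : {ffun seq_sub es -> label}) : uniq ts ->
    \sum_(f : {ffun seq_sub es -> label} | [forall t, (t \notin ts) ==> (f t == g t)])
      F (env_of f) = lsum (map val ts) F (env_of g).
  elim: ts g => [|t ts IH] g.
    move=> _; rewrite (big_pred1 g) // => f; apply/forallP/eqP => [fg|-> t].
      by apply/ffunP => t; have /implyP/(_ isT)/eqP := fg t.
    by rewrite eqxx implybT.
  case/andP=> t_ts ts_uniq.
  rewrite (partition_big (fun f : {ffun seq_sub es -> label} => f t) xpredT) //=.
  apply: eq_bigr => l _; pose g' := [ffun s => if s == t then l else g s].
  have -> : upd (env_of g) (val t) l = env_of g'.
    apply: functional_extensionality => e; rewrite /upd /env_of.
    case: insubP => [s _ <-|] /=; first by rewrite ffunE -val_eqE.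
    by case: eqP => // ->; rewrite (valP t).
  rewrite -IH //; apply: eq_bigl => f; apply/andP/forallP => [[/forallP fg /eqP ft] s|fg].
    apply/implyP => s_ts; rewrite ffunE; case: (eqVneq s t) => [->|st]; first by rewrite ft.
    by have /implyP := fg s; rewrite inE negb_or st; apply.
  split; last by have /implyP/(_ t_ts) := fg t; rewrite ffunE eqxx.
  apply/forallP => s; apply/implyP; rewrite inE negb_or => /andP[st s_ts].
  by have /implyP/(_ s_ts) := fg s; rewrite ffunE (negPf st).
have -> : (fun=> L0) = env_of [ffun _ : seq_sub es => L0].
  by apply: functional_extensionality => e; rewrite /env_of; case: insub => //= s; rewrite ffunE.
rewrite -(@lsum_perm _ (map val (enum {: seq_sub es})) es).
- rewrite -H ?enum_uniq //; apply: eq_bigl => f.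
  by apply/esym/forallP => t; rewrite mem_enum.
- by rewrite (map_inj_uniq val_inj) enum_uniq.
apply: uniq_perm => //; first by rewrite (map_inj_uniq val_inj) enum_uniq.
move=> e; apply/mapP/idP => [[t _ ->]|e_es]; first exact: valP.
by exists (SeqSub e_es) => //; rewrite mem_enum.
Qed.

Lemma mem_hex_edges a e : (e \in hex_edges a) = edge_in_hex a e.
Proof.
rewrite mem_filter; case E: (edge_in_hex a e) => //; rewrite andTb.
case: e E => [[d x] y] E; apply/allpairsP; exists ((d, x), y).
have [xa ya] : (x < (2 * a).+1)%N /\ (y < (2 * a).+1)%N.
  by case: d E; rewrite /= /in_hex; lia.
rewrite mem_iota ya; split=> //; apply/allpairsP; exists (d, x).
by rewrite mem_iota xa; split=> //; case: (d).
Qed.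

Lemma uniq_hex_edges a : uniq (hex_edges a).
Proof.
apply: filter_uniq; apply: allpairs_uniq; rewrite ?iota_uniq //.
  by apply: allpairs_uniq; rewrite ?iota_uniq // => -[d x] [d' x'] _ _ [-> ->].
by move=> [d x] [d' x'] _ _ [-> ->].
Qed.

(* Hexagon edges with integer coordinates, so that the embeddings below are
   injective. *)
Definition iedge : Type := (dir * int * int)%type.

Definition to_int (e : edge) : iedge := let: (d, x, y) := e in (d, x%:Z, y%:Z).

Lemma to_int_inj : injective to_int.
Proof. by move=> [[d x] y] [[d' x'] y'] [-> -> ->]. Qed.

Section Embeddings.
Variable a : nat.

(* The six triangles between the center and the sides of the hexagon, numbered
   clockwise from the one on the North-West side, as images of the triangle
   with vertices (0, 0), (a, 0), (0, a). The odd ones are up-pointing; the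
   vertex (x, y) goes to (x, a + y), (a - x, 2a - y), (2a - x - y, a + x),
   (2a - x, a - y), (a + x, y) and (x + y, a - x). *)
Definition rho (i : nat) (e : edge) : iedge :=
  let A := a%:Z in let: (d, x, y) := e in let X := x%:Z in let Y := y%:Z in
  match i, d with
  | 1%N, _ => (d, X, A + Y)
  | 2%N, D0 => (D0, A - X - 1, 2 * A - Y)
  | 2%N, D60 => (D60, A - X, 2 * A - Y - 1)
  | 2%N, D120 => (D120, A - X - 1, 2 * A - Y - 1)
  | 3%N, D0 => (D120, 2 * A - X - Y - 1, A + X)
  | 3%N, D60 => (D0, 2 * A - X - Y - 1, A + X)
  | 3%N, D120 => (D60, 2 * A - X - Y - 1, A + X)
  | 4%N, D0 => (D0, 2 * A - X - 1, A - Y)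
  | 4%N, D60 => (D60, 2 * A - X, A - Y - 1)
  | 4%N, D120 => (D120, 2 * A - X - 1, A - Y - 1)
  | 5%N, _ => (d, A + X, Y)
  | _, D0 => (D120, X + Y, A - X - 1)
  | _, D60 => (D0, X + Y, A - X)
  | _, D120 => (D60, X + Y + 1, A - X - 1)
  end.

Lemma rho_inj i : injective (rho i).
Proof.
move=> [[d x] y] [[d' x'] y'].
case: i => [|[|[|[|[|[|i]]]]]]; case: d; case: d' => //=; case=> ? ?;
  congr (_, _, _); lia.
Qed.

(** Linear inequalities for the images of the interior edges; with those of [in_seg] they reduce the
    decomposition of the hexagon to linear arithmetic. *)
Definition in_rho (i : nat) (e : iedge) : bool :=
  let A := a%:Z in let: (d, X, Y) := e in
  match i, d with
  | 1%N, D0 => [&& 0 <= X, A < Y & X + Y < 2 * A]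
  | 1%N, D60 => [&& 0 < X, A <= Y & X + Y < 2 * A]
  | 1%N, D120 => [&& 0 <= X, A <= Y & X + Y + 1 < 2 * A]
  | 2%N, D0 => [&& X < A, Y < 2 * A & 2 * A <= X + Y]
  | 2%N, D60 => [&& X < A, Y < 2 * A & 2 * A <= X + Y]
  | 2%N, D120 => [&& X < A, Y < 2 * A & 2 * A <= X + Y]
  | 3%N, D0 => [&& A < Y, X + Y < 3 * A & A <= X]
  | 3%N, D60 => [&& A <= Y, X + Y < 3 * A & A < X]
  | 3%N, D120 => [&& A <= Y, X + Y + 1 < 3 * A & A <= X]
  | 4%N, D0 => [&& X < 2 * A, Y < A & 2 * A <= X + Y]
  | 4%N, D60 => [&& X < 2 * A, Y < A & 2 * A <= X + Y]
  | 4%N, D120 => [&& X < 2 * A, Y < A & 2 * A <= X + Y]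
  | 5%N, D0 => [&& A <= X, 0 < Y & X + Y < 2 * A]
  | 5%N, D60 => [&& A < X, 0 <= Y & X + Y < 2 * A]
  | 5%N, D120 => [&& A <= X, 0 <= Y & X + Y + 1 < 2 * A]
  | _, D0 => [&& Y < A, A <= X + Y & X < A]
  | _, D60 => [&& Y < A, A <= X + Y & X < A]
  | _, D120 => [&& Y < A, A <= X + Y & X < A]
  end.

Definition rho_inv (i : nat) (e : iedge) : edge :=
  let A := a%:Z in let: (d, X, Y) := e in
  match i, d with
  | 1%N, _ => (d, absz (X)%R, absz (Y - A)%R)
  | 2%N, D0 => (D0, absz (A - X - 1)%R, absz (2 * A - Y)%R)
  | 2%N, D60 => (D60, absz (A - X)%R, absz (2 * A - Y - 1)%R)
  | 2%N, D120 => (D120, absz (A - X - 1)%R, absz (2 * A - Y - 1)%R)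
  | 3%N, D120 => (D0, absz (Y - A)%R, absz (3 * A - 1 - X - Y)%R)
  | 3%N, D0 => (D60, absz (Y - A)%R, absz (3 * A - 1 - X - Y)%R)
  | 3%N, D60 => (D120, absz (Y - A)%R, absz (3 * A - 1 - X - Y)%R)
  | 4%N, D0 => (D0, absz (2 * A - X - 1)%R, absz (A - Y)%R)
  | 4%N, D60 => (D60, absz (2 * A - X)%R, absz (A - Y - 1)%R)
  | 4%N, D120 => (D120, absz (2 * A - X - 1)%R, absz (A - Y - 1)%R)
  | 5%N, _ => (d, absz (X - A)%R, absz (Y)%R)
  | _, D120 => (D0, absz (A - 1 - Y)%R, absz (X + Y + 1 - A)%R)
  | _, D0 => (D60, absz (A - Y)%R, absz (X + Y - A)%R)
  | _, D60 => (D120, absz (A - 1 - Y)%R, absz (X + Y - A)%R)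
  end.

Lemma count_rho i e : count_mem e (map (rho i) (interior a)) = in_rho i e.
Proof.
rewrite count_uniq_mem ?(map_inj_uniq (@rho_inj i)) ?uniq_interior //.
congr nat_of_bool; apply/mapP/idP => [[[[d x] y] + ->]|].
  rewrite mem_interior.
  by case: i => [|[|[|[|[|[|i]]]]]]; case: d => /=; lia.
move=> eP; exists (rho_inv i e); case: e eP => [[d X] Y];
  case: i => [|[|[|[|[|[|i]]]]]]; case: d; rewrite /in_rho /rho_inv ?mem_interior;
  (try lia); rewrite /rho => eP; congr (_, _, _); lia.
Qed.

Definition seg (d : dir) (x y u v : int) : seq iedge :=
  [seq (d, x + u * i%:Z, y + v * i%:Z) | i <- iota 0 a].

Definition in_seg (d : dir) (x y u v : int) (e : iedge) : bool :=
  [&& e.1.1 == d, u * (e.2 - y) == v * (e.1.2 - x) &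
    if u == 0 then 0 <= v * (e.2 - y) < a%:Z else 0 <= u * (e.1.2 - x) < a%:Z].

Lemma count_seg d x y u v e :
  (u, v) \in [:: (1, 0); (-1, 0); (0, 1); (0, -1); (1, -1); (-1, 1) : int * int] ->
  count_mem e (seg d x y u v) = in_seg d x y u v e.
Proof.
move=> uv; rewrite count_uniq_mem; last first.
  rewrite map_inj_uniq ?iota_uniq // => i j [].
  by move: uv; rewrite !inE => /or4P[|||/or3P[||]] /eqP[-> ->]; lia.
congr nat_of_bool; apply/mapP/idP => [[i]|].
  rewrite mem_iota /in_seg => /andP[_ ia] -> /=; rewrite eqxx.
  by move: uv; rewrite !inE => /or4P[|||/or3P[||]] /eqP[-> ->] /=; lia.
case: e => [[d' X] Y] /and3P[/= /eqP -> e1 e2].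
exists (absz (if u == 0 then v * (Y - y) else u * (X - x))).
  by rewrite mem_iota; move: e2; case: ifP; lia.
by move: uv e1 e2; rewrite !inE => /or4P[|||/or3P[||]] /eqP[-> ->] /= e1 e2;
  congr (_, _, _); lia.
Qed.

Definition outer : seq (seq iedge) := let A := a%:Z in
  [:: seg D120 (A - 1) 0 (-1) 1; seg D60 0 A 0 1; seg D0 0 (2 * A) 1 0;
      seg D120 A (2 * A - 1) 1 (-1); seg D60 (2 * A) (A - 1) 0 (-1);
      seg D0 (2 * A - 1) 0 (-1) 0].

(* The sides of the six triangles that meet at the center, in the order and
   with the orientations of xi, tau, lambda, mu, rho, sigma. *)
Definition radial : seq (seq iedge) := let A := a%:Z in
  [:: seg D120 0 (2 * A - 1) 1 (-1); seg D120 (2 * A - 1) 0 (-1) 1;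
      seg D60 A A 0 1; seg D0 0 A 1 0; seg D0 (2 * A - 1) A (-1) 0;
      seg D60 A (A - 1) 0 (-1)].

Definition inner : seq iedge :=
  flatten [seq map (rho i) (interior a) | i <- [:: 1; 2; 3; 4; 5; 6]%N].

Local Ltac decide_counts :=
  first [exfalso; lia |
    repeat match goal with
    | |- context [nat_of_bool ?b] =>
      lazymatch b with
      | true => fail
      | false => fail
      | _ => first [have -> : b = true by lia | have -> : b = false by lia]
      end
    end; done].

(** Both lists contain each edge equally often: an edge of the hexagon lies on exactly one side,
    radius or open triangle. *)
Lemma hex_edges_perm :
  perm_eq (map to_int (hex_edges a)) (flatten outer ++ flatten radial ++ inner).
Proof.
apply/allP => e _; apply/eqP.
rewrite /inner /outer /radial /= !count_cat !count_rho !count_seg //=.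
rewrite count_uniq_mem ?(map_inj_uniq to_int_inj) ?uniq_hex_edges // !addn0.
have -> : (e \in map to_int (hex_edges a)) = let A := a%:Z in
    let hex X Y := [&& 0 <= X, X <= 2 * A, 0 <= Y, Y <= 2 * A, A <= X + Y & X + Y <= 3 * A] in
    let: (d, X, Y) := e in match d with
      | D0 => hex X Y && hex (X + 1) Y
      | D60 => hex X Y && hex X (Y + 1)
      | D120 => hex (X + 1) Y && hex X (Y + 1)
    end.
  apply/mapP/idP => [[[[d x] y] + ->]|].
    by rewrite mem_hex_edges; case: d; rewrite /= /in_hex; lia.
  case: e => [[d X] Y] eP; exists (d, absz X, absz Y).
    by rewrite mem_hex_edges; case: d eP; rewrite /= /in_hex; lia.
  by case: d eP => eP; congr (_, _, _); lia.
(* For each direction the cases are cut out by the outer sides and the three diagonals through the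
   center. *)
case: e => [[d X] Y]; case: d; rewrite /in_seg /=.
- case: (boolP (_ && _)) => hex; last by decide_counts.
  case: (boolP (Y == 0)) => Y0; first by decide_counts.
  case: (boolP (Y == 2 * a%:Z)) => Y2; first by decide_counts.
  case: (boolP (X < a%:Z)) => Xa; case: (boolP (Y == a%:Z)) => Ya; try by decide_counts.
    by case: (boolP (Y < a%:Z)) => Ya'; case: (boolP (X + Y < 2 * a%:Z)) => XY; decide_counts.
  by case: (boolP (Y < a%:Z)) => Ya'; case: (boolP (X + Y < 2 * a%:Z)) => XY; decide_counts.
- case: (boolP (_ && _)) => hex; last by decide_counts.
  case: (boolP (X == 0)) => X0; first by decide_counts.
  case: (boolP (X == 2 * a%:Z)) => X2; first by decide_counts.
  case: (boolP (Y < a%:Z)) => Ya; case: (boolP (X == a%:Z)) => Xa; try by decide_counts.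
    by case: (boolP (X < a%:Z)) => Xa'; case: (boolP (X + Y < 2 * a%:Z)) => XY; decide_counts.
  by case: (boolP (X < a%:Z)) => Xa'; case: (boolP (X + Y < 2 * a%:Z)) => XY; decide_counts.
case: (boolP (_ && _)) => hex; last by decide_counts.
case: (boolP (X + Y + 1 == a%:Z)) => S1; first by decide_counts.
case: (boolP (X + Y + 1 == 3 * a%:Z)) => S3; first by decide_counts.
case: (boolP (X < a%:Z)) => Xa; case: (boolP (X + Y + 1 == 2 * a%:Z)) => S2; try by decide_counts.
  by case: (boolP (Y < a%:Z)) => Ya; case: (boolP (X + Y < 2 * a%:Z)) => XY; decide_counts.
by case: (boolP (Y < a%:Z)) => Ya; case: (boolP (X + Y < 2 * a%:Z)) => XY; decide_counts.
Qed.

End Embeddings.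

Arguments seg : simpl never.

Lemma eq_tri_ok n (g h : edge -> label) :
  (forall d x y, (x + y < n)%N -> g (d, x, y) = h (d, x, y)) -> tri_ok n g = tri_ok n h.
Proof.
move=> gh; apply: eq_forallb => x; apply: eq_forallb => y; congr andb.
  by case: (ltnP (x + y)) => //= xy; rewrite /up_ok !gh.
by case: (ltnP (x + y.+1)) => //= xy; rewrite /down_ok !gh //; lia.
Qed.

(** * Factorization over the six triangles *)

Definition ncount (u v w : seq label) : int := (count_mem w (tri u v))%:R.

Section Hexagon.
Variable a : nat.

Definition indices : seq nat := [:: 1; 2; 3; 4; 5; 6]%N.

Lemma rho_disjoint i j d x y : i \in indices -> j \in indices -> i != j ->
  (x + y < a)%N -> rho a i (d, x, y) \notin map (rho a j) (interior a).
Proof.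
move=> iP jP ij xy; rewrite -has_pred1 has_count count_rho -leqNgt leqn0 eqb0.
move: iP jP ij; rewrite !inE.
case/or4P=> [|||/or3P[||]] /eqP->; case/or4P=> [|||/or3P[||]] /eqP-> //= _;
  case: d => /=; lia.
Qed.

Definition tri_count i (F : iedge -> label) : int :=
  ncount (map (F \o rho a i) (nw_side a)) (map (F \o rho a i) (ne_side a))
    (map (F \o rho a i) (s_side a)).

Lemma eq_tri_count i (F G : iedge -> label) :
  (forall d x y, (x + y < a)%N -> F (rho a i (d, x, y)) = G (rho a i (d, x, y))) ->
  tri_count i F = tri_count i G.
Proof.
move=> FG; rewrite /tri_count.
congr ncount; rewrite /nw_side /ne_side /s_side -!map_comp; apply/eq_in_map => k;
  rewrite mem_iota add0n => /andP[_ ka]; apply: FG; lia.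
Qed.

(** No triangle has an edge in the interior of another, so the sums over the interiors separate. *)
Lemma lsum_inner (s : seq nat) (F : iedge -> label) : uniq s -> {subset s <= indices} ->
  lsum (flatten [seq map (rho a i) (interior a) | i <- s])
    (fun G => \prod_(i <- s) (tri_ok a (G \o rho a i))%:R) F =
  \prod_(i <- s) tri_count i F.
Proof.
elim: s F => [|i s IH] F; first by rewrite /= !big_nil.
case/andP=> is_ s_uniq sub; rewrite [flatten _]/= lsum_cat.
have i_in : i \in indices by apply: sub; rewrite mem_head.
have s_in j : j \in s -> j \in indices by move=> js; apply: sub; rewrite inE js orbT.
transitivity (lsum (map (rho a i) (interior a))
  (fun G => (\prod_(j <- s) tri_count j G) * (tri_ok a (G \o rho a i))%:R) F).
  apply: eq_lsum => G _; rewrite -(IH G s_uniq s_in) mulrC.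
  under eq_lsum => H _ do rewrite big_cons.
  apply: (@lsum_mull _ _ _ (fun G => (tri_ok a (G \o rho a i))%:R)) => H HG.
  congr (nat_of_bool _)%:R; apply: eq_tri_ok => d x y xy; apply: HG.
  apply/flatten_mapP => -[j js]; apply/negP; apply: rho_disjoint => //; first exact: s_in.
  by apply: contraNneq is_ => ->.
rewrite (@lsum_mull _ _ _ (fun G => \prod_(j <- s) tri_count j G)) => [|G GF].
  rewrite big_cons mulrC (lsum_map _ (fun g => (tri_ok a g)%:R)); last exact: rho_inj.
  by rewrite lsum_tri.
apply: eq_big_seq => j js; apply: eq_tri_count => d x y xy; apply: GF.
by apply: rho_disjoint => //; [apply: s_in|apply: contraNneq is_ => <-].
Qed.

Lemma outer_uniq : uniq (flatten (outer a) ++ flatten (radial a) ++ inner a).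
Proof. by rewrite -(perm_uniq (hex_edges_perm a)) (map_inj_uniq to_int_inj) uniq_hex_edges. Qed.

Lemma rev_seg d x y u v :
  rev (seg a d x y u v) = seg a d (x + u * (a%:Z - 1)) (y + v * (a%:Z - 1)) (- u) (- v).
Proof.
apply: (@eq_from_nth _ (D0, 0, 0)); rewrite size_rev !size_map // size_iota => i ia.
rewrite nth_rev ?size_map ?size_iota // !(nth_map 0%N) ?size_iota //; last by lia.
rewrite !nth_iota //; last by lia.
have -> : ((0 + (a - i.+1))%N : int) = a%:Z - 1 - i%:Z by lia.
by congr (_, _, _); ring.
Qed.

(** Each [rho] brings the sides of its triangle into the order of the arguments of [lr]; a side that
    is listed in the opposite direction appears reversed. *)
Lemma tri_countE (F : iedge -> label) :
  \prod_(i <- indices) tri_count i F =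
  let os := map (map F) (outer a) in let rs := map (map F) (radial a) in
  let o := nth [::] os in let r := nth [::] rs in
  ncount (o 1%N) (r 0%N) (r 3%N) * ncount (rev (r 2%N)) (rev (r 0%N)) (rev (o 2%N)) *
  ncount (r 4%N) (r 2%N) (rev (o 3%N)) * ncount (o 4%N) (r 1%N) (r 4%N) *
  ncount (rev (r 5%N)) (rev (r 1%N)) (rev (o 5%N)) * ncount (r 3%N) (r 5%N) (rev (o 0%N)).
Proof.
have revE d x y u v : rev (map F (seg a d x y u v)) =
    map F (seg a d (x + u * (a%:Z - 1)) (y + v * (a%:Z - 1)) (- u) (- v)).
  by rewrite -map_rev rev_seg.
rewrite /= !revE !big_cons big_nil mulr1 !mulrA /tri_count !(map_comp F (rho a _)).
have mapE i (f : nat -> edge) d x y u v :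
    (forall k, (k < a)%N -> rho a i (f k) = (d, x + u * k%:Z, y + v * k%:Z)) ->
    map (rho a i) [seq f k | k <- iota 0 a] = seg a d x y u v.
  by move=> fE; rewrite -map_comp; apply/eq_in_map => k; rewrite mem_iota => /andP[_ /fE].
congr (_ * _ * _ * _ * _ * _); congr ncount; congr map; apply: mapE => k ka /=;
  congr (_, _, _); lia.
Qed.
End Hexagon.

(** * Unit triangles of the hexagon and of its six parts *)

Section HexPieces.
Variables (a : nat) (F : iedge -> label).

Definition up_piece (X Y : int) := piece (F (D60, X, Y)) (F (D120, X, Y)) (F (D0, X, Y)).
Definition down_piece (X Y : int) :=
  piece (F (D0, X, Y + 1)) (F (D60, X + 1, Y)) (F (D120, X, Y)).

(** Embeddings with even number exchange the two kinds of pieces; the cyclic shifts of labels caused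
    by rotations are absorbed by [piece_rot]. *)
Lemma up_rho i x y : let A := a%:Z in let X := x%:Z in let Y := y%:Z in
  i \in indices -> up_ok (F \o rho a i) x y =
  match i with
  | 1%N => up_piece X (A + Y)
  | 2%N => down_piece (A - X - 1) (2 * A - Y - 1)
  | 3%N => up_piece (2 * A - X - Y - 1) (A + X)
  | 4%N => down_piece (2 * A - X - 1) (A - Y - 1)
  | 5%N => up_piece (A + X) Y
  | _ => down_piece (X + Y) (A - X - 1)
  end.
Proof.
rewrite !inE /up_ok /up_piece /down_piece.
case/or4P=> [|||/or3P[||]] /eqP-> /=.
- by [].
- rewrite [RHS]piece_rot; congr (piece (F _) (F _) (F _)); congr (_, _, _); lia.
- by rewrite piece_rot.
- rewrite [RHS]piece_rot; congr (piece (F _) (F _) (F _)); congr (_, _, _); lia.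
- by [].
- congr (piece (F _) (F _) (F _)); congr (_, _, _); lia.
Qed.

Lemma down_rho i x y : let A := a%:Z in let X := x%:Z in let Y := y%:Z in
  i \in indices -> down_ok (F \o rho a i) x y =
  match i with
  | 1%N => down_piece X (A + Y)
  | 2%N => up_piece (A - X - 1) (2 * A - Y - 1)
  | 3%N => down_piece (2 * A - X - Y - 2) (A + X)
  | 4%N => up_piece (2 * A - X - 1) (A - Y - 1)
  | 5%N => down_piece (A + X) Y
  | _ => up_piece (X + Y + 1) (A - X - 1)
  end.
Proof.
rewrite !inE /down_ok /up_piece /down_piece.
case/or4P=> [|||/or3P[||]] /eqP-> /=.
- congr (piece (F _) (F _) (F _)); congr (_, _, _); lia.
- rewrite [LHS]piece_rot; congr (piece (F _) (F _) (F _)); congr (_, _, _); lia.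
- rewrite [LHS]piece_rot; congr (piece (F _) (F _) (F _)); congr (_, _, _); lia.
- rewrite [LHS]piece_rot; congr (piece (F _) (F _) (F _)); congr (_, _, _); lia.
- congr (piece (F _) (F _) (F _)); congr (_, _, _); lia.
- rewrite [LHS]piece_rot [LHS]piece_rot; congr (piece (F _) (F _) (F _)); congr (_, _, _); lia.
Qed.

Definition hex_up_ok (g : edge -> label) :=
  [forall x : 'I_(2 * a), forall y : 'I_(2 * a),
     [&& in_hex a x y, in_hex a x.+1 y & in_hex a x y.+1] ==>
     allowed_piece (g (D60, val x, val y)) (g (D120, val x, val y)) (g (D0, val x, val y))].

Definition hex_down_ok (g : edge -> label) :=
  [forall x : 'I_(2 * a), forall y : 'I_(2 * a),
     [&& in_hex a x.+1 y, in_hex a x y.+1 & in_hex a x.+1 y.+1] ==>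
     allowed_piece (g (D0, val x, y.+1)) (g (D60, x.+1, val y)) (g (D120, val x, val y))].

Lemma hex_up_okP : reflect
  (forall x y : nat, [&& in_hex a x y, in_hex a x.+1 y & in_hex a x y.+1] ->
    up_piece x%:Z y%:Z) (hex_up_ok (F \o to_int)).
Proof.
apply: (iffP forallP) => [H x y xy|H x].
  have [xa ya] : (x < 2 * a)%N /\ (y < 2 * a)%N by move: xy; rewrite /in_hex; lia.
  have /forallP/(_ (Ordinal ya))/implyP/(_ xy) := H (Ordinal xa).
  by rewrite pieceE.
by apply/forallP => y; apply/implyP => /H; rewrite pieceE.
Qed.

Lemma hex_down_okP : reflect
  (forall x y : nat, [&& in_hex a x.+1 y, in_hex a x y.+1 & in_hex a x.+1 y.+1] ->
    down_piece x%:Z y%:Z) (hex_down_ok (F \o to_int)).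
Proof.
have downE x y : down_piece x%:Z y%:Z = piece ((F \o to_int) (D0, x, y.+1))
    ((F \o to_int) (D60, x.+1, y)) ((F \o to_int) (D120, x, y)).
  rewrite /down_piece /=; congr (piece (F _) (F _) (F _)); congr (_, _, _); lia.
apply: (iffP forallP) => [H x y xy|H x].
  have [xa ya] : (x < 2 * a)%N /\ (y < 2 * a)%N by move: xy; rewrite /in_hex; lia.
  have /forallP/(_ (Ordinal ya))/implyP/(_ xy) := H (Ordinal xa).
  by rewrite pieceE downE.
by apply/forallP => y; apply/implyP => /H; rewrite pieceE downE.
Qed.

Lemma hex_pieces : hex_up_ok (F \o to_int) && hex_down_ok (F \o to_int) =
  all (fun i => tri_ok a (F \o rho a i)) indices.
Proof.
apply/andP/allP => [[/hex_up_okP up /hex_down_okP down] i iP|ok].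
  have upZ X Y : 0 <= X -> 0 <= Y -> a%:Z <= X + Y -> X + Y + 1 <= 3 * a%:Z ->
      X + 1 <= 2 * a%:Z -> Y + 1 <= 2 * a%:Z -> up_piece X Y.
    case: X => // x _; case: Y => // y _ *; apply: up; rewrite /in_hex; lia.
  have downZ X Y : 0 <= X -> 0 <= Y -> a%:Z <= X + Y + 1 -> X + Y + 2 <= 3 * a%:Z ->
      X + 1 <= 2 * a%:Z -> Y + 1 <= 2 * a%:Z -> down_piece X Y.
    case: X => // x _; case: Y => // y _ *; apply: down; rewrite /in_hex; lia.
  apply/tri_okP; split=> x y xy; rewrite ?up_rho ?down_rho //; move: iP; rewrite !inE.
    by case/or4P=> [|||/or3P[||]] /eqP->; (apply: upZ || apply: downZ); lia.
  by case/or4P=> [|||/or3P[||]] /eqP->; (apply: upZ || apply: downZ); lia.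
have up_eq X Y X' Y' : up_piece X Y -> X = X' -> Y = Y' -> up_piece X' Y'.
  by move=> ? <- <-.
have down_eq X Y X' Y' : down_piece X Y -> X = X' -> Y = Y' -> down_piece X' Y'.
  by move=> ? <- <-.
have upk i x y : i \in indices -> (x + y < a)%N -> up_ok (F \o rho a i) x y.
  by move=> /ok /tri_okP[H _]; apply: H.
have downk i x y : i \in indices -> (x + y.+1 < a)%N -> down_ok (F \o rho a i) x y.
  by move=> /ok /tri_okP[_ H]; apply: H.
split; [apply/hex_up_okP|apply/hex_down_okP] => x y; rewrite /in_hex => xy.
(* The diagonals through the center decide which triangle contains the piece; its coordinates there
   come from inverting [rho]. *)
- case: (ltnP y a) => ya; case: (ltnP x a) => xa.
  + have lt : ((a - 1 - y) + ((x + y - a)).+1 < a)%N by lia.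
    by have := @downk 6 _ _ isT lt; rewrite down_rho // => /up_eq; apply; lia.
  + case: (ltnP (x + y) (2 * a)) => xya.
      have lt : ((x - a) + y < a)%N by lia.
    by have := @upk 5 _ _ isT lt; rewrite up_rho // => /up_eq; apply; lia.
    have lt : ((2 * a - 1 - x) + ((a - 1 - y)).+1 < a)%N by lia.
    by have := @downk 4 _ _ isT lt; rewrite down_rho // => /up_eq; apply; lia.
  + case: (ltnP (x + y) (2 * a)) => xya.
      have lt : (x + (y - a) < a)%N by lia.
    by have := @upk 1 _ _ isT lt; rewrite up_rho // => /up_eq; apply; lia.
    have lt : ((a - 1 - x) + ((2 * a - 1 - y)).+1 < a)%N by lia.
    by have := @downk 2 _ _ isT lt; rewrite down_rho // => /up_eq; apply; lia.
  + have lt : ((y - a) + (3 * a - 1 - x - y) < a)%N by lia.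
    by have := @upk 3 _ _ isT lt; rewrite up_rho // => /up_eq; apply; lia.
- case: (ltnP y a) => ya; case: (ltnP x a) => xa.
  + have lt : ((a - 1 - y) + (x + y + 1 - a) < a)%N by lia.
    by have := @upk 6 _ _ isT lt; rewrite up_rho // => /down_eq; apply; lia.
  + case: (ltnP (x + y + 1) (2 * a)) => xya.
      have lt : ((x - a) + (y).+1 < a)%N by lia.
    by have := @downk 5 _ _ isT lt; rewrite down_rho // => /down_eq; apply; lia.
    have lt : ((2 * a - 1 - x) + (a - 1 - y) < a)%N by lia.
    by have := @upk 4 _ _ isT lt; rewrite up_rho // => /down_eq; apply; lia.
  + case: (ltnP (x + y + 1) (2 * a)) => xya.
      have lt : (x + ((y - a)).+1 < a)%N by lia.
    by have := @downk 1 _ _ isT lt; rewrite down_rho // => /down_eq; apply; lia.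
    have lt : ((a - 1 - x) + (2 * a - 1 - y) < a)%N by lia.
    by have := @upk 2 _ _ isT lt; rewrite up_rho // => /down_eq; apply; lia.
  + have lt : ((y - a) + ((3 * a - 2 - x - y)).+1 < a)%N by lia.
    by have := @downk 3 _ _ isT lt; rewrite down_rho // => /down_eq; apply; lia.
Qed.
End HexPieces.

(** * Reduction to words on the radii *)

Definition side_ok a k (g : edge -> label) (side : nat -> edge) (s : bstr a k) :=
  [forall i : 'I_a, g (side i) == label_of_bit (bit s i)].

Lemma side_okE a k g side (s : bstr a k) :
  side_ok g side s = ([seq g (side i) | i <- iota 0 a] == lab (val s)).
Proof.
apply/forallP/eqP => [H|H i].
  apply: (@eq_from_nth _ L0); rewrite !size_map size_iota ?size_tuple // => i ia.
  rewrite (nth_map 0%N) ?size_iota // nth_iota // (nth_map false) ?size_tuple //.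
  exact/eqP/(H (Ordinal ia)).
have ia := ltn_ord i; have := congr1 (fun l => nth L0 l i) H.
rewrite /= (nth_map 0%N) ?size_iota // nth_iota // add0n => ->.
by rewrite (nth_map false) ?size_tuple.
Qed.

Lemma sum_wordss_cat ns1 ns2 (K : seq (seq label) -> int) :
  \sum_(ws <- wordss (ns1 ++ ns2)) K ws =
  \sum_(ws1 <- wordss ns1) \sum_(ws2 <- wordss ns2) K (ws1 ++ ws2).
Proof.
elim: ns1 K => [|n ns1 IH] K; first by rewrite big_seq1.
rewrite [(n :: ns1) ++ ns2]/= !sum_wordss; apply: eq_bigr => w _.
exact: (IH (fun ws => K (w :: ws))).
Qed.

Section HexCount.
Variables (a k : nat) (al be ga de ep ze : bstr a k).

Definition hex_ok (g : edge -> label) : bool :=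
  [&& hex_up_ok a g, hex_down_ok a g,
      side_ok g (side_SW a) al, side_ok g (side_NW a) be,
      side_ok g (side_N a) ga, side_ok g (side_NE a) de,
      side_ok g (side_SE a) ep & side_ok g (side_S a) ze].

Definition outer_labels : seq (seq label) :=
  [seq lab (tval (val s)) | s <- [:: al; be; ga; de; ep; ze]].

Lemma hex_okE (F : iedge -> label) : (hex_ok (F \o to_int))%:R =
  (map (map F) (outer a) == outer_labels)%:R *
  \prod_(i <- indices) (tri_ok a (F \o rho a i))%:R :> int.
Proof.
have -> : \prod_(i <- indices) (tri_ok a (F \o rho a i))%:R =
    (all (fun i => tri_ok a (F \o rho a i)) indices)%:R :> int.
  elim: indices => [|i s IH]; first by rewrite big_nil.
  by rewrite big_cons IH -natrM mulnb.
rewrite -hex_pieces -natrM mulnb; congr (nat_of_bool _)%:R.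
rewrite /hex_ok !side_okE andbA [LHS]andbC; congr (_ && _).
rewrite /outer /outer_labels /= !eqseq_cons andbT.
have segE side d x y u v (s : bstr a k) :
    (forall i, (i < a)%N -> to_int (side i) = (d, x + u * i%:Z, y + v * i%:Z)) ->
    ([seq (F \o to_int) (side i) | i <- iota 0 a] == lab (val s)) =
    (map F (seg a d x y u v) == lab (val s)).
  move=> sideE; congr (_ == _); rewrite /seg -map_comp; apply/eq_in_map => i.
  by rewrite mem_iota => /andP[_ /sideE] /= ->.
congr andb; first by apply: (segE (side_SW a)) => i ia; rewrite /side_SW /=; congr (_, _, _); lia.
congr andb; first by apply: (segE (side_NW a)) => i ia; rewrite /side_NW /=; congr (_, _, _); lia.
congr andb; first by apply: (segE (side_N a)) => i ia; rewrite /side_N /=; congr (_, _, _); lia.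
congr andb; first by apply: (segE (side_NE a)) => i ia; rewrite /side_NE /=; congr (_, _, _); lia.
congr andb; first by apply: (segE (side_SE a)) => i ia; rewrite /side_SE /=; congr (_, _, _); lia.
by apply: (segE (side_S a)) => i ia; rewrite /side_S /=; congr (_, _, _); lia.
Qed.

Lemma Hex_words : (Hex al be ga de ep ze)%:Z =
  \sum_(rs <- wordss (nseq 6 a))
    let o := nth [::] outer_labels in let r := nth [::] rs in
    ncount (o 1%N) (r 0%N) (r 3%N) * ncount (rev (r 2%N)) (rev (r 0%N)) (rev (o 2%N)) *
    ncount (r 4%N) (r 2%N) (rev (o 3%N)) * ncount (o 4%N) (r 1%N) (r 4%N) *
    ncount (rev (r 5%N)) (rev (r 1%N)) (rev (o 5%N)) * ncount (r 3%N) (r 5%N) (rev (o 0%N)).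
Proof.
rewrite /Hex -sum1_card -[LHS]natz natr_sum big_mkcond.
pose L0f := fun _ : iedge => L0.
transitivity (lsum (map to_int (hex_edges a)) (fun F => (hex_ok (F \o to_int))%:R) L0f).
  rewrite (lsum_map _ (fun g => (hex_ok g)%:R) _ to_int_inj).
  rewrite -(sum_ffun_lsum _ (uniq_hex_edges a)); apply: eq_bigr => f _.
  by rewrite inE -[hex_puzzle _ _ _ _ _ _ _]/(hex_ok (env_of f)); case: hex_ok.
rewrite (lsum_perm _ _ _ (hex_edges_perm a)); last first.
  by rewrite (map_inj_uniq to_int_inj) uniq_hex_edges.
have := outer_uniq a; rewrite catA cat_uniq -flatten_cat => /and3P[or_uniq disj _].
rewrite lsum_cat.
(* Six outer words come first, then six radial ones; the indicator will collapse the sum over the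
   outer words to the prescribed labels. *)
pose K (ws : seq (seq label)) : int := (take 6 ws == outer_labels)%:R *
  let o := nth [::] (take 6 ws) in let r := nth [::] (drop 6 ws) in
  ncount (o 1%N) (r 0%N) (r 3%N) * ncount (rev (r 2%N)) (rev (r 0%N)) (rev (o 2%N)) *
  ncount (r 4%N) (r 2%N) (rev (o 3%N)) * ncount (o 4%N) (r 1%N) (r 4%N) *
  ncount (rev (r 5%N)) (rev (r 1%N)) (rev (o 5%N)) * ncount (r 3%N) (r 5%N) (rev (o 0%N)).
transitivity (lsum (flatten (outer a ++ radial a))
  (fun F => K (map (map F) (outer a ++ radial a))) L0f).
  apply: eq_lsum => F _.
  under eq_lsum => G _ do rewrite hex_okE.
  rewrite (@lsum_mull _ _ _ (fun G => (map (map G) (outer a) == outer_labels)%:R)).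
    rewrite lsum_inner // tri_countE /K map_cat.
    by [].
  move=> G GF; congr ((_ == _)%:R); apply/eq_in_map => es es_outer; apply/eq_in_map => e e_es.
  apply: GF; apply: contra disj => e_inner; apply/hasP; exists e => //.
  by rewrite flatten_cat mem_cat; apply/orP; left; apply/flattenP; exists es.
have sizes : map size (outer a ++ radial a) = nseq 6 a ++ nseq 6 a.
  by rewrite /outer /radial /seg /= !size_map !size_iota.
have outer_in : outer_labels \in wordss (nseq 6 a).
  by rewrite mem_wordss /= !size_map !size_tuple.
rewrite lsum_wordss // sizes sum_wordss_cat (bigD1_seq _ outer_in) ?uniq_wordss //.
rewrite -[LHS]/(_ + _) [X in _ + X]big1_seq ?addr0 => [|os /andP[os_ne]]; last first.
  rewrite mem_wordss => /eqP os6; have {}os6 : size os = 6%N.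
    by rewrite -(size_map size) os6.
  by rewrite big1 // => rs _; rewrite /K take_size_cat // (negPf os_ne) mul0r.
apply: eq_bigr => rs _.
by rewrite /K take_size_cat // drop_size_cat // eqxx mul1r.
Qed.
End HexCount.

(** * Binary strings on the radii *)

Section Radii.
Variables (a k : nat).

Definition is_bstr (w : seq label) : bool :=
  [&& size w == a, count_mem L10 w == 0 & count_mem L1 w == k]%N.

Lemma is_bstrP w : reflect (exists s : bstr a k, w = lab (tval (val s))) (is_bstr w).
Proof.
apply: (iffP and3P) => [[/eqP sw /eqP w0 /eqP wk]|[s ->]]; last first.
  have [_ -> ->] := count_lab (tval (val s)).
  by rewrite size_map size_tuple !eqxx; split=> //; case: s.
have w01 : L10 \notin w by rewrite -has_pred1 has_count w0.
have st : size (map (pred1 L1) w) == a by rewrite size_map sw.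
have sk : count id (tval (Tuple st)) == k by rewrite /= count_map -wk; apply/eqP/eq_count.
by exists (exist _ (Tuple st) sk); rewrite /= labK.
Qed.

Lemma sum_words_bstr (F : seq label -> int) :
  (forall w, w \in words a -> F w != 0 -> is_bstr w) ->
  \sum_(w <- words a) F w = \sum_(s : bstr a k) F (lab (tval (val s))).
Proof.
move=> FP; transitivity (\sum_(w <- words a)
    \sum_(s : bstr a k) if w == lab (tval (val s)) then F w else 0).
  apply: eq_big_seq => w wP; case: (eqVneq (F w) 0) => [F0|/(FP w wP) /is_bstrP[s sE]].
    by rewrite big1 ?F0 // => s _; rewrite if_same.
  rewrite (bigD1 s) //= -sE eqxx big1 ?addr0 // => t ts.
  case: eqP => // wt; case/eqP: ts; apply: val_inj; apply: val_inj.
  by apply: lab_inj; rewrite -[LHS]wt.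
rewrite exchange_big; apply: eq_bigr => s _.
rewrite (bigD1_seq (lab (tval (val s)))) ?uniq_words //= ?eqxx ?big1 ?addr0 //.
  by move=> w /negPf->.
by rewrite mem_words size_map size_tuple.
Qed.

Fixpoint bstr_sum n (K : seq (bstr a k) -> int) : int :=
  if n is n'.+1 then \sum_(s : bstr a k) bstr_sum n' (fun ss => K (s :: ss)) else K [::].

Lemma sum_wordss_bstr n (P : seq (seq label) -> int) :
  (forall rs, rs \in wordss (nseq n a) -> P rs != 0 -> all is_bstr rs) ->
  \sum_(rs <- wordss (nseq n a)) P rs =
  bstr_sum n (fun ss => P [seq lab (tval (val s)) | s <- ss]).
Proof.
elim: n P => [|n IH] P PP; first by rewrite big_seq1.
have consP w rs : w \in words a -> rs \in wordss (nseq n a) ->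
    w :: rs \in wordss (nseq n.+1 a).
  by rewrite !mem_wordss mem_words /= eqseq_cons => -> ->.
rewrite [nseq _ _]/= sum_wordss sum_words_bstr => [|w wP].
  apply: eq_bigr => s _; apply: (IH (fun rs => P (lab (tval (val s)) :: rs))) => rs rsP.
  have sP : lab (tval (val s)) \in words a by rewrite mem_words size_map size_tuple.
  by move/(PP _ (consP _ _ sP rsP)) => /= /andP[].
apply: contraR => wN; rewrite big1_seq // => rs /andP[_ rsP]; apply/eqP.
by apply: contraR wN => /(PP _ (consP _ _ wP rsP)) /= /andP[].
Qed.

Lemma ncount_colors u v w : size u = a -> size v = a -> ncount u v w != 0 ->
  [/\ count_mem L0 u + count_mem L1 v + count_mem L10 w = a,
      count_mem L10 u + count_mem L0 v + count_mem L1 w = a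
    & count_mem L1 u + count_mem L10 v + count_mem L0 w = a]%N.
Proof.
move=> su sv; rewrite /ncount pnatr_eq0 -lt0n -has_count has_pred1 => wP.
have suv : size u = size v by rewrite su sv.
by split; rewrite -su; [apply: (color_tri is_color1 suv wP)|
  apply: (color_tri is_color2 suv wP)|apply: (color_tri is_color3 suv wP)].
Qed.

(* Clockwise around the center, the number of labels 10 drops from a radius to
   the next one by the number of labels 10 on the previous radius. Hence it is
   constant, and zero. *)
Lemma radii_bstr (s0 s1 s2 s3 s4 s5 : bstr a k) (xi ta la mu rh si : seq label) :
  let o (s : bstr a k) := lab (tval (val s)) in
  all (fun w => size w == a) [:: xi; ta; la; mu; rh; si] ->
  ncount (o s1) xi mu * ncount (rev la) (rev xi) (rev (o s2)) *
  ncount rh la (rev (o s3)) * ncount (o s4) ta rh *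
  ncount (rev si) (rev ta) (rev (o s5)) * ncount mu si (rev (o s0)) != 0 ->
  all is_bstr [:: xi; ta; la; mu; rh; si].
Proof.
move=> o /=; rewrite andbT => /and5P[/eqP sxi /eqP sta /eqP sla /eqP smu /andP[/eqP srh /eqP ssi]].
rewrite !mulf_eq0 !negb_or => /andP[/andP[/andP[/andP[/andP[n1 n2] n3] n4] n5] n6].
have so s : size (o s) = a by rewrite size_map size_tuple.
have co s : [/\ count_mem L10 (o s) = 0, count_mem L1 (o s) = k &
    count_mem L0 (o s) + k = a]%N.
  have [-> -> ->] := count_lab (tval (val s)).
  have ck : count id (tval (val s)) = k by apply/eqP; case: (s).
  have cp := count_predC id (tval (val s)); rewrite size_tuple ck in cp.
  by split=> //; rewrite addnC.
have [a1 a2 a3] := ncount_colors (so _) sxi n1.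
have [b1 b2 b3] := ncount_colors (etrans (size_rev _) sla) (etrans (size_rev _) sxi) n2.
have [c1 c2 c3] := ncount_colors srh sla n3.
have [d1 d2 d3] := ncount_colors (so _) sta n4.
have [e1 e2 e3] := ncount_colors (etrans (size_rev _) ssi) (etrans (size_rev _) sta) n5.
have [f1 f2 f3] := ncount_colors smu ssi n6.
have [o00 o01 o02] := co s0; have [o10 o11 o12] := co s1; have [o20 o21 o22] := co s2.
have [o30 o31 o32] := co s3; have [o40 o41 o42] := co s4; have [o50 o51 o52] := co s5.
have total w : size w = a -> (count_mem L0 w + count_mem L1 w + count_mem L10 w = a)%N.
  by move=> <-; elim: w => //= -[] w IH /=; lia.
have t1 := total _ sxi; have t2 := total _ sta; have t3 := total _ sla.
have t4 := total _ smu; have t5 := total _ srh; have t6 := total _ ssi.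
rewrite !count_rev in b1 b2 b3 c1 c2 c3 e1 e2 e3 f1 f2 f3.
rewrite /is_bstr sxi sta sla smu srh ssi !eqxx /=.
rewrite ?(o00, o01, o10, o11, o20, o21, o30, o31, o40, o41, o50, o51)
  in a1 a2 a3 b1 b2 b3 c1 c2 c3 d1 d2 d3 e1 e2 e3 f1 f2 f3.
move: a1 b1 c1 d1 e1 f1 a2 b2 c2 d2 e2 f2 a3 b3 c3 d3 e3 f3 t1 t2 t3 t4 t5 t6.
move: o02 o12 o22 o32 o42 o52.
move: (count_mem L0 xi) (count_mem L1 xi) (count_mem L10 xi) => zxi oxi txi.
move: (count_mem L0 ta) (count_mem L1 ta) (count_mem L10 ta) => zta ota tta.
move: (count_mem L0 la) (count_mem L1 la) (count_mem L10 la) => zla ola tla.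
move: (count_mem L0 mu) (count_mem L1 mu) (count_mem L10 mu) => zmu omu tmu.
move: (count_mem L0 rh) (count_mem L1 rh) (count_mem L10 rh) => zrh orh trh.
move: (count_mem L0 si) (count_mem L1 si) (count_mem L10 si) => zsi osi tsi.
move: (count_mem L0 (o s0)) (count_mem L0 (o s1)) (count_mem L0 (o s2)) => y0 y1 y2.
move: (count_mem L0 (o s3)) (count_mem L0 (o s4)) (count_mem L0 (o s5)) => y3 y4 y5.
clear; lia.
Qed.
End Radii.

Theorem theorem12 (a a1 : nat) (ha1 : (a1 <= a)%N)
    (alpha beta gamma delta epsilon zeta : bstr a a1) :
  (Hex alpha beta gamma delta epsilon zeta)%:Z =
  \sum_(xi : bstr a a1) \sum_(tau : bstr a a1) \sum_(lambda : bstr a a1)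
  \sum_(mu : bstr a a1) \sum_(rho : bstr a a1) \sum_(sigma : bstr a a1)
    lr beta xi mu * lr (brev lambda) (brev xi) (brev gamma)
    * lr rho lambda (brev delta) * lr epsilon tau rho
    * lr (brev sigma) (brev tau) (brev zeta) * lr mu sigma (brev alpha).
Proof.
(* Only radii labeled by binary strings with a1 ones contribute, which turns the sum over words into
   the six nested sums. *)
rewrite Hex_words (@sum_wordss_bstr a a1) => [|rs]; last first.
  rewrite mem_wordss => sizes; have rs6 : size rs = 6%N by rewrite -(size_map size) (eqP sizes).
  case: rs rs6 sizes => [|w1 [|w2 [|w3 [|w4 [|w5 [|w6 [|w7 rs]]]]]]] // _ sizes.
  have {}sizes : all (fun w => size w == a) [:: w1; w2; w3; w4; w5; w6].
    by move: sizes; rewrite /= !eqseq_cons.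
  exact: (radii_bstr (s0 := alpha) (s1 := beta) (s2 := gamma) (s3 := delta)
    (s4 := epsilon) (s5 := zeta) sizes).
have ncountE (s t u : bstr a a1) :
    ncount (lab (tval (val s))) (lab (tval (val t))) (lab (tval (val u))) = lr s t u.
  by rewrite lrE /ncount natz.
have labrev (s : bstr a a1) : rev (lab (tval (val s))) = lab (tval (val (brev s))).
  by rewrite /lab -map_rev.
do 6![apply: eq_bigr => ? _].
by rewrite /= !labrev !ncountE.
Qed.
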